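(* Let $n\ge3$, let $q$ be a power of an odd prime, and let $G_{2^{n+1}}=\langle a,b\mid a^{2^n}=1,\ b^2=1,\ b^{-1}ab=a^{1+2^{n-1}}\rangle$. The semisimple group algebra $\mathbb{F}_qG_{2^{n+1}}$ decomposes into minimal left ideals generated by a complete set of primitive orthogonal idempotents, given by: (i) $4+2\sum_{j=2}^{n-1}\dfrac{\phi(2^j)}{o_{2^j}(q)}$ central idempotents, namely those corresponding to the strong Shoda pairs of the form $(G_{2^{n+1}},K)$; (ii) $2\dfrac{\phi(2^n)}{\kappa\,o_{2^n}(q)}$ left idempotents $e_{2^n,k}\widehat{\langle b\rangle}$ and $e_{2^n,k}(1-\widehat{\langle b\rangle})$, where $\kappa=2$ if $1+2^{n-1}\notin\langle q\rangle\bmod 2^n$ and $\kappa=1$ in all other cases.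
   Context: $\phi$ is Euler's totient; $o_m(q)$ is the multiplicative order of $q$ modulo $m$; $\langle q\rangle\bmod 2^n$ is the subgroup of $(\mathbb{Z}/2^n)^*$ generated by $q$. For a subgroup $X$, $\widehat X=\frac1{|X|}\sum_{x\in X}x$. Write $G=G_{2^{n+1}}$. For subgroups $K\trianglelefteq H\trianglelefteq G$ with $H/K$ cyclic, let $\chi$ be a faithful character $H/K\to\overline{\mathbb{F}}_q^{\,*}$, $C=C_q(\chi)=\{\chi^{q^t}:t\ge0\}$, and $$\epsilon_C(H,K)=\frac1{[H:K]}\widehat K\sum_{\overline h\in H/K}\operatorname{tr}(\chi(\overline h))h^{-1},$$ with $\operatorname{tr}$ the trace from $\mathbb{F}_q(\xi_{[H:K]})$ to $\mathbb{F}_q$, where $\xi_{[H:K]}\in\overline{\mathbb{F}}_q$ is a primitive $[H:K]$-th root of unity. $e_C(G,H,K)$ denotes the sum of the distinct $G$-conjugates of $\epsilon_C(H,K)$. The central idempotents in (i) are the elements $e_C(G,G,K)$ with $K$ one of $G,\ \langle a\rangle,\ \langle a^2,b\rangle,\ \langle a^2,ab\rangle$, or $\langle a^{2^j},b\rangle,\ \langle a^{2^{j-1}}b\rangle$ for $2\le j\le n-1$, and $C$ running over all cosets $C_q(\chi)$ of faithful characters $\chi$ of $G/K$. The elements $e_{2^n,k}$ are $e_C(G,\langle a\rangle,\langle1\rangle)$ with $C=C_q(\gamma^k)$, where $\gamma$ is a fixed faithful character of $\langle a\rangle$ and $k$ runs over odd integers representing the distinct $G$-orbits (under conjugation) of the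 cosets $C_q(\gamma^k)$. *)

(* Defs.v *)
From HB Require Import structures.
From mathcomp Require Import all_boot all_order all_fingroup all_algebra.
From mathcomp Require Import all_solvable all_character.
From mathcomp Require Import boolp classical_sets.
Set Implicit Arguments.
Unset Strict Implicit.
Unset Printing Implicit Defensive.
Import GroupScope GRing.Theory.
Local Open Scope group_scope.
Local Open Scope ring_scope.

(* The isomorphism with Grp (...) says that G is the (finite) presented group; as
   moreover a and b generate G and satisfy the relations, comparing orders
   shows that G is presented on the generators a and b. *)
Definition presented_by_ab (gT : finGroupType) (G : {group gT}) (n : nat)
    (a b : gT) : Prop :=
  [/\ G :=: <<[set a; b]>>%g, (a ^+ (2 ^ n) = 1)%g, (b ^+ 2 = 1)%g,
      (a ^ b = a ^+ (1 + 2 ^ n.-1)%N)%g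
    & G \isog Grp (x : y : x ^+ (2 ^ n), y ^+ 2,
                           x ^ y = x ^+ (1 + 2 ^ n.-1)%N)].

(* The class of k in the unit group of Z/m; used only for 1 < m and k coprime
   to m (the junk value for the other cases is 1). *)
Definition unit_mod (m k : nat) : {unit 'Z_m} := insubd (1%g : {unit 'Z_m}) k%:R.

Definition order_mod (m q : nat) : nat := #[unit_mod m q]%g.

Section Trace.
Variables (F : fieldType) (L : closedFieldType) (iota : {rmorphism F -> L}).

(* F[xi], which is the field F(xi) because xi will be algebraic over F. *)
Definition adjoin (xi : L) : set L :=
  fun y => exists p : {poly F}, y = (map_poly iota p).[xi].

Definition is_basis (E : set L) (d : nat) (e : 'I_d -> L) : Prop :=
  (forall y : L, E y <-> exists v : 'rV[F]_d, y = \sum_i iota (v 0 i) * e i) /\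
  (forall v : 'rV[F]_d, \sum_i iota (v 0 i) * e i = 0 -> v = 0).

(* t is the trace from F(xi) to F of x, i.e. the trace of the F-linear
   endomorphism y |-> x y of F(xi), computed in some F-basis of F(xi). *)
Definition is_trace (xi x : L) (t : F) : Prop :=
  exists (d : nat) (e : 'I_d -> L) (A : 'M[F]_d),
    [/\ is_basis (adjoin xi) e,
        forall i, x * e i = \sum_j iota (A i j) * e j
      & t = \tr A].

(* The trace from F(xi_m) to F for a primitive m-th root of unity xi_m; neither
   F(xi_m) nor the trace depends on the choice of xi_m. *)
Definition cyc_trace (m : nat) (x : L) : F :=
  xget 0 (fun t => exists2 xi : L, m.-primitive_root xi & is_trace xi x t).
End Trace.

(* A homomorphism from A to the multiplicative group of L; the values of chi
   outside A are irrelevant. *)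
Definition is_char (gT : finGroupType) (L : fieldType) (A : {set gT})
    (chi : gT -> L) : Prop :=
  chi 1%g = 1 /\ {in A &, {morph chi : x y / (x * y)%g >-> x * y}}.

Definition faithful_char (gT : finGroupType) (L : fieldType) (A : {set gT})
    (chi : gT -> L) : Prop :=
  is_char A chi /\ {in A &, injective chi}.

(* C_q(chi), as a set of functions: membership only depends on the values
   on A, so that equality of such sets is equality of sets of characters. *)
Definition cyc_coset (gT : finGroupType) (L : fieldType) (q : nat)
    (A : {set gT}) (chi : gT -> L) : set (gT -> L) :=
  fun psi => exists t : nat, {in A, forall x, psi x = chi x ^+ (q ^ t)}.

Definition conj_coset (gT : finGroupType) (L : fieldType)
    (C : set (gT -> L)) (g : gT) : set (gT -> L) :=
  fun psi => exists2 theta, C theta & psi = fun x => theta (x ^ g^-1)%g.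

(* The group algebra FG is group_ring F G, the algebra spanned by the matrices
   aG g of the regular representation; aG is multiplicative, so the order of
   products is that of FG. *)
Section GroupAlgebra.
Variables (F : finFieldType) (L : closedFieldType) (iota : {rmorphism F -> L}).
Variables (gT : finGroupType) (G : {group gT}).
Local Notation aG := (regular_repr F G).

Definition hat (X : {set gT}) : 'M[F]_#|G| :=
  #|X|%:R^-1 *: gset_mx F G X.

(* As K is normal in H, hat K *m aG h^-1 only depends on the coset of h, so the
   representative chosen by repr is irrelevant. *)
Definition eps (H K : {group gT}) (chi : coset_of K -> L) : 'M[F]_#|G| :=
  #|H : K|%:R^-1 *:
    (hat K *m \sum_(X in (H / K)%g)
       cyc_trace iota #|H : K| (chi X) *: aG (repr X)^-1%g).

(* The index is a set of matrices, so each distinct conjugate counts once. *)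
Definition eC (H K : {group gT}) (chi : coset_of K -> L) : 'M[F]_#|G| :=
  \sum_(x in [set aG g^-1%g *m eps H chi *m aG g | g in G]) x.

Definition shoda_kernels (n : nat) (a b : gT) : seq {group gT} :=
  [:: G; <[a]>; <<[set (a ^+ 2)%g; b]>>; <<[set (a ^+ 2)%g; (a * b)%g]>> ]%G
  ++ flatten [seq [:: <<[set (a ^+ (2 ^ j))%g; b]>>;
                      <[(a ^+ (2 ^ j.-1) * b)%g]> ]%G | j <- index_iota 2 n].

Definition is_eC_top (K : {group gT}) (e : 'M[F]_#|G|) : Prop :=
  exists2 chi : coset_of K -> L, faithful_char (G / K)%g chi & e = eC G chi.

Definition central_part (n : nat) (a b : gT) : {set 'M[F]_#|G|} :=
  [set e | has (fun K => `[< is_eC_top K e >]) (shoda_kernels n a b)].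

(* gamma is a character of <[a]>; it is transported to <[a]> / 1 via repr, the
   cosets of the trivial group being singletons. *)
Definition eC_cyclic (a : gT) (gamma : gT -> L) (k : int) : 'M[F]_#|G| :=
  eC <[a]>%G (fun X : coset_of 1%G => gamma (repr X) ^ k).

Definition left_part (a b : gT) (gamma : gT -> L) (ks : seq int) :
    {set 'M[F]_#|G|} :=
  [set:: [seq eC_cyclic a gamma k *m hat <[b]> | k <- ks] ++
         [seq eC_cyclic a gamma k *m (1%:M - hat <[b]>) | k <- ks]].
End GroupAlgebra.

Definition same_orbit (gT : finGroupType) (L : fieldType) (q : nat)
    (G : {group gT}) (a : gT) (gamma : gT -> L) (k l : int) : Prop :=
  exists2 g, g \in G &
    cyc_coset q <[a]> (fun x => gamma x ^ l) =
    conj_coset (cyc_coset q <[a]> (fun x => gamma x ^ k)) g.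

Definition orbit_representatives (gT : finGroupType) (L : fieldType) (q : nat)
    (G : {group gT}) (a : gT) (gamma : gT -> L) (ks : seq int) : Prop :=
  [/\ uniq ks,
      {in ks, forall k, odd `|k|%N},
      {in ks &, forall k l, same_orbit q G a gamma k l -> k = l}
    & forall l : int, odd `|l|%N ->
        exists2 k, k \in ks & same_orbit q G a gamma k l].

Section Algebra.
Variables (F : fieldType) (m n : nat) (A : 'A[F]_(m, n)).

Definition idempotent_in (e : 'M[F]_n) : Prop := (e \in A)%MS /\ e *m e = e.

Definition primitive_idempotent (e : 'M[F]_n) : Prop :=
  [/\ idempotent_in e, e != 0
    & forall f g : 'M[F]_n, idempotent_in f -> idempotent_in g ->
        f *m g = 0 -> g *m f = 0 -> e = f + g -> f = 0 \/ g = 0].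

Definition is_left_ideal (m' : nat) (I : 'A[F]_(m', n)) : Prop :=
  (I <= A)%MS /\ left_mx_ideal A I.

Definition minimal_left_ideal (m' : nat) (I : 'A[F]_(m', n)) : Prop :=
  [/\ is_left_ideal I, I != 0
    & forall (m'' : nat) (J : 'A[F]_(m'', n)),
        is_left_ideal J -> (J <= I)%MS -> J != 0 -> (I <= J)%MS].

Definition left_ideal_gen (e : 'M[F]_n) : 'A[F]_(n ^ 2, n) :=
  (A * (mxvec e : 'A[F]_(1, n)))%MS.
End Algebra.

Definition complete_primitive_orthogonal (F : finFieldType) (m n : nat)
    (A : 'A[F]_(m, n)) (E : {set 'M[F]_n}) : Prop :=
  [/\ {in E, forall e, primitive_idempotent A e},
      {in E &, forall e f, e != f -> e *m f = 0}
    & \sum_(e in E) e = 1%:M].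

Definition sum_of_minimal_left_ideals (F : finFieldType) (m n : nat)
    (A : 'A[F]_(m, n)) (E : {set 'M[F]_n}) : Prop :=
  [/\ {in E, forall e, minimal_left_ideal A (left_ideal_gen A e)},
      mxdirect (\sum_(e in E) left_ideal_gen A e)
    & (\sum_(e in E) left_ideal_gen A e :=: A)%MS].

(* Main.v *)
Require Import Defs.
From mathcomp Require Import boolp classical_sets.
From HB Require Import structures.
From mathcomp Require Import all_boot all_order all_fingroup all_algebra.
From mathcomp Require Import all_solvable all_field all_character.
Set Implicit Arguments.
Unset Strict Implicit.
Unset Printing Implicit Defensive.
Import GroupScope GRing.Theory.
Local Open Scope ring_scope.

(* Over the closed field L, put s = 2^(n-1) and let E_l be the idempotent of <a>
   attached to gamma^l; the E_l sum to 1. The element eps_C is the sum of the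
   idempotents of the characters in the q-coset C, since the trace to F of a root of
   unity is the sum of its Frobenius conjugates. For l even, E_l commutes with b and
   splits into the idempotents of the two linear characters of G extending gamma^l;
   their kernels are the groups of shoda_kernels. For l odd, conjugation by b sends
   E_l to E_(l(1+s)), and e_k is the sum of the E_l with l in k<q, 1+s>. On this
   component a^s acts as -1 and F[a^2] e_k is a field, because all the gamma^l (a^2)
   with l in k<q, 1+s> are Frobenius conjugates. As every element of FG e_k hat<b>
   has the form (c0 + c1 a) e_k hat<b> with c0, c1 in F[a^2], and (1 +- b)/2 separates
   the two summands, each nonzero element generates the whole left ideal. Completeness holds
   because the sum of all idempotents fixes every E_l. The idempotents are counted by
   the cosets of <q>, respectively <q, 1+s>, in the unit groups of Z/2^j. *)

(** * Frobenius and traces of cyclotomic extensions *)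

(** The definitions take traces in an arbitrary basis, choose coset representatives with [repr] and
    sum over sets of distinct conjugates. So each idempotent over F is characterised instead by its
    image over L, through [orbit_idem]: there it is a sum of orthogonal idempotents of linear
    characters, and since entrywise [iota] is injective, equality, orthogonality and nonvanishing
    become questions about characters. Whether conjugation by b fixes eps_C or moves it depends on
    whether 1+s lies in <q> modulo 2^n. Summing over the set of distinct conjugates treats both
    cases at once; the distinction reappears only in the count, where kappa comes from the order of
    the group <q, 1+s>. Inverses are explicit: an element that acts through nonzero values in the
    field with q^o elements is inverted by its own power q^o - 2, which visibly stays in FG. *)

Section Frobenius.
Variables (F : finFieldType) (L : closedFieldType) (iota : {rmorphism F -> L}).
Local Notation q := #|F|.

Lemma card_field_gt1 : (1 < q)%N.
Proof. exact: finNzRing_gt1. Qed.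

Lemma pchar_nat_card t : [pchar L].-nat (q ^ t)%N.
Proof.
have [p p_pr pF] := finPcharP F.
rewrite pnatX; apply/orP; left.
rewrite (card_pprimeChar pF) pnatX; apply/orP; left.
by rewrite pnatE // (rmorph_pchar iota).
Qed.

Lemma frobD t (x y : L) : (x + y) ^+ (q ^ t) = x ^+ (q ^ t) + y ^+ (q ^ t).
Proof. exact/exprDn_pchar/pchar_nat_card. Qed.

Lemma expq_gt0 t : (0 < q ^ t)%N.
Proof. by rewrite expn_gt0 (ltnW card_field_gt1). Qed.

Lemma frob_sum t (I : Type) (r : seq I) (P : pred I) (x : I -> L) :
  (\sum_(i <- r | P i) x i) ^+ (q ^ t) = \sum_(i <- r | P i) x i ^+ (q ^ t).
Proof.
apply: (big_morph (fun y => y ^+ (q ^ t))); first exact: frobD.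
by rewrite expr0n gtn_eqF ?expq_gt0.
Qed.

Lemma frob_iota t (c : F) : iota c ^+ (q ^ t) = iota c.
Proof.
elim: t => [|t IHt]; first by rewrite expr1.
by rewrite expnS exprM -rmorphXn expf_card.
Qed.

Lemma frob_inj t : injective (fun x : L => x ^+ (q ^ t)).
Proof.
move=> x y /= xy; have: (x - y) ^+ (q ^ t) == 0.
  by apply/eqP/(addIr (y ^+ (q ^ t))); rewrite -frobD subrK xy add0r.
by rewrite expf_eq0 subr_eq0 => /andP[_ /eqP].
Qed.

(** X^q - X splits over F with the elements of F as roots, so it has no further roots in L. *)
Lemma frob_fix (y : L) : y ^+ q = y -> exists c, y = iota c.
Proof.
move=> /eqP; rewrite -subr_eq0 => yq.
have: (map_poly iota ('X^q - 'X)).[y] == 0.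
  by rewrite rmorphB /= map_polyXn map_polyX !hornerE.
rewrite finField_genPoly rmorph_prod horner_prod => /prodf_eq0 [c _].
rewrite rmorphB /= map_polyX map_polyC !hornerE subr_eq0 => /eqP ->.
by exists c.
Qed.

Lemma frob_horner t (p : {poly F}) x :
  (map_poly iota p).[x] ^+ (q ^ t) = (map_poly iota p).[x ^+ (q ^ t)].
Proof.
rewrite !horner_coef frob_sum; apply: eq_bigr => i _.
by rewrite exprMn coef_map frob_iota -!exprM mulnC.
Qed.

Lemma frobM (x : L) s t : x ^+ (q ^ s) ^+ (q ^ t) = x ^+ (q ^ (s + t)).
Proof. by rewrite expnD exprM. Qed.

Lemma frob_mul_period (z : L) o k :
  z ^+ (q ^ o) = z -> z ^+ (q ^ (k * o)) = z.
Proof.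
by move=> zo; elim: k => [|k IHk]; rewrite ?expr1 // mulSn -frobM zo.
Qed.

Lemma frob_mod (z : L) o t :
  z ^+ (q ^ o) = z -> z ^+ (q ^ (t %% o)) = z ^+ (q ^ t).
Proof. by move=> zo; rewrite {2}(divn_eq t o) -frobM frob_mul_period. Qed.

Section Period.
Variables (xi : L) (o : nat).
Hypotheses (o_gt0 : (0 < o)%N)
           (xi_o : forall t, (xi ^+ (q ^ t) == xi) = (o %| t)%N).

(** The Vandermonde matrix of the first o conjugates of xi. By [xi_o] they are pairwise distinct: a
    coincidence between two exponents below o would give a positive period shorter than o. *)
Let W : 'M[L]_o := Vandermonde o (\row_t xi ^+ (q ^ t)).

Let WE j t : W j t = xi ^+ (q ^ t) ^+ j.
Proof. by rewrite !mxE. Qed.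

Let W_unit : W \in unitmx.
Proof.
rewrite unitmxE unitfE det_Vandermonde.
apply/prodf_neq0 => i _; apply/prodf_neq0 => j lt_ij; rewrite !mxE subr_eq0.
apply/negP => /eqP xij.
have le_ij : (i <= j)%N by exact: ltnW.
have /frob_inj/eqP : xi ^+ (q ^ (j - i)) ^+ (q ^ i) = xi ^+ (q ^ i).
  by rewrite frobM subnK.
rewrite xi_o => /dvdn_leq; rewrite subn_gt0 => /(_ lt_ij).
by rewrite leqNgt (leq_ltn_trans (leq_subr _ _)).
Qed.

Let xi_per : xi ^+ (q ^ o) = xi. Proof. by apply/eqP; rewrite xi_o. Qed.

Lemma adjoin_period y : adjoin iota xi y -> y ^+ (q ^ o) = y.
Proof. by case=> p ->; rewrite frob_horner xi_per. Qed.

(* The coordinates of y, obtained over L by inverting the Vandermonde matrix of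
   the conjugates of xi, are fixed by the Frobenius. *)
Lemma period_coord y : y ^+ (q ^ o) = y ->
  exists v : 'rV[F]_o, y = \sum_j iota (v 0 j) * xi ^+ j.
Proof.
move=> yo; pose yr : 'rV[L]_o := \row_t y ^+ (q ^ t).
pose v := yr *m invmx W; have vW : v *m W = yr by rewrite mulmxKV.
(* Raising the system v W = yr to the q-th power only permutes its equations cyclically, because y
   and xi both have period o. So v' solves the same system, and v' = v as W is invertible. *)
pose v' : 'rV[L]_o := \row_j v 0 j ^+ q.
have v'W : v' *m W = yr.
  apply/rowP => t; rewrite !mxE.
  (* The predecessor of t modulo o: equation t for v' is the q-th power of equation t0 for v. *)
  pose t0 := Ordinal (ltn_pmod (t + o.-1) o_gt0).
  have t0E (z : L) : z ^+ (q ^ o) = z -> z ^+ (q ^ t0) ^+ q = z ^+ (q ^ t).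
    move=> zo; rewrite /= frob_mod // -{2}(expn1 q) frobM -addnA addn1.
    by rewrite prednK // addnC -frobM zo.
  rewrite -(t0E y) //; move/rowP/(_ t0): vW; rewrite !mxE => <-.
  rewrite -(expn1 q) frob_sum; apply: eq_bigr => j _.
  rewrite !mxE expn1 exprMn; congr (_ * _).
  by rewrite [RHS]exprAC t0E.
have v'v : v' = v by rewrite -[v'](mulmxK W_unit) v'W.
have vF j : exists c, v 0 j = iota c.
  by apply: frob_fix; move/rowP/(_ j): v'v; rewrite mxE.
have [c cE] := choice vF.
exists (\row_j c j); move/rowP/(_ (Ordinal o_gt0)): vW; rewrite !mxE expr1 => <-.
by apply: eq_bigr => j _; rewrite cE !mxE expn0 expr1.
Qed.

Lemma coord_adjoin (v : 'rV[F]_o) :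
  adjoin iota xi (\sum_j iota (v 0 j) * xi ^+ j).
Proof.
exists (\poly_(j < o) (if insub j is Some i then v 0 i else 0)).
rewrite horner_coef; set p := \poly_(_ < _) _.
have sz : (size (map_poly iota p) <= o)%N by rewrite size_map_poly size_poly.
rewrite (big_ord_widen _ (fun i => (map_poly iota p)`_i * xi ^+ i) sz).
rewrite [RHS]big_mkcond; apply: eq_bigr => j _; case: ifP => [_|].
  by rewrite coef_map coef_poly ltn_ord valK.
rewrite ltnNge => /negbFE /(nth_default 0); rewrite coef_map coef_poly ltn_ord.
by rewrite valK => ->; rewrite mul0r.
Qed.

(** The Frobenius powers of one relation form a linear system with the invertible matrix [W]. *)
Lemma coord_free (v : 'rV[F]_o) : \sum_j iota (v 0 j) * xi ^+ j = 0 -> v = 0.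
Proof.
move=> v0; have vW : map_mx iota v *m W = 0.
  apply/rowP => t; rewrite !mxE; move/(congr1 (fun y => y ^+ (q ^ t))): v0.
  rewrite expr0n gtn_eqF ?expq_gt0 // frob_sum => v0; rewrite -{}[RHS]v0.
  by apply: eq_bigr => j _; rewrite !mxE exprMn frob_iota exprAC.
have: map_mx iota v = 0 by rewrite -[map_mx _ _](mulmxK W_unit) vW mul0mx.
by move/eqP; rewrite map_mx_eq0 => /eqP.
Qed.

Lemma adjoin_power_basis : is_basis iota (adjoin iota xi) (fun j : 'I_o => xi ^+ j).
Proof.
split; last exact: coord_free.
by move=> y; split=> [/adjoin_period/period_coord // | [v ->]]; apply: coord_adjoin.
Qed.

(** Existence of a trace keeps the choice made in [cyc_trace] from falling back on its default value
    0. *)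
Lemma trace_exists x : adjoin iota xi x -> exists t, is_trace iota xi x t.
Proof.
move=> /adjoin_period xo.
have xv (i : 'I_o) : exists v : 'rV[F]_o,
    x * xi ^+ i = \sum_j iota (v 0 j) * xi ^+ j.
  by apply: period_coord; rewrite exprMn xo exprAC xi_per.
have [v vE] := choice xv.
exists (\tr (\matrix_i v i)), o, (fun j : 'I_o => xi ^+ j), (\matrix_i v i).
split=> //; first exact: adjoin_power_basis.
by move=> i; rewrite vE; apply: eq_bigr => j _; rewrite !mxE.
Qed.

(* With V the matrix of the conjugates of the basis and D the diagonal matrix of
   the conjugates of x, the matrix A of the multiplication by x satisfies
   A V = V D, and V = C W, W = P V with C P = 1. *)
Lemma is_trace_conj x c : is_trace iota xi x c ->
  iota c = \sum_(t < o) x ^+ (q ^ t).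
Proof.
case=> d [e [A [[eE e_free] xe ->]]].
have eo i : e i ^+ (q ^ o) = e i.
  apply/adjoin_period/eE; exists (delta_mx 0 i).
  rewrite (bigD1 i) //= mxE !eqxx rmorph1 mul1r big1 ?addr0 // => j /negbTE ij.
  by rewrite mxE ij rmorph0 mul0r.
have [C CE] := choice (fun i => period_coord (eo i)).
have Px (j : 'I_o) : exists v : 'rV[F]_d, xi ^+ j = \sum_i iota (v 0 i) * e i.
  by apply/eE; exists 'X^j; rewrite map_polyXn hornerXn.
have [P PE] := choice Px.
pose Cm := \matrix_i C i; pose Pm := \matrix_j P j.
have CP : Cm *m Pm = 1%:M.
  apply/row_matrixP => i; rewrite row_mul -[LHS](subrK (row i 1%:M)).
  rewrite -[RHS]add0r; congr (_ + _); apply: e_free.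
  under eq_bigr do rewrite mxE rmorphD mulrDl.
  rewrite big_split /= -[X in _ + X]opprK; apply/eqP; rewrite subr_eq0.
  rewrite (_ : - (\sum_j _) = e i); last first.
    rewrite (bigD1 i) //= !mxE eqxx rmorphN rmorph1 mulN1r opprD opprK big1.
      by rewrite subr0.
    by move=> j; rewrite !mxE eq_sym => /negbTE->; rewrite oppr0 rmorph0 mul0r.
  apply/eqP; rewrite [RHS]CE; under [RHS]eq_bigr do rewrite PE mulr_sumr.
  rewrite [RHS]exchange_big; apply: eq_bigr => j _ /=.
  rewrite mxE rmorph_sum mulr_suml; apply: eq_bigr => k _.
  by rewrite !mxE rmorphM mulrA.
pose V : 'M[L]_(d, o) := \matrix_(i, t) e i ^+ (q ^ t).
pose D : 'M[L]_o := diag_mx (\row_t x ^+ (q ^ t)).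
have PV : map_mx iota Pm *m V = W.
  apply/matrixP => j t; rewrite WE exprAC PE frob_sum mxE.
  by apply: eq_bigr => i _; rewrite !mxE exprMn frob_iota.
have AV : map_mx iota A *m V = V *m D.
  apply/matrixP => i t; rewrite mul_mx_diag !mxE -exprMn mulrC xe frob_sum.
  by apply: eq_bigr => j _; rewrite !mxE exprMn frob_iota.
have CW : map_mx iota Cm *m W = V.
  by rewrite -PV mulmxA -map_mxM CP map_mx1 mul1mx.
(* The given basis has d elements and the power basis has o; cyclicity of the trace together with C
   P = 1 passes from d x d to o x o matrices. *)
have trA : \tr A = \tr (Pm *m A *m Cm) by rewrite mxtrace_mulC mulmxA CP mul1mx.
rewrite trA -trace_map_mx !map_mxM.
have -> : map_mx iota Pm *m map_mx iota A *m map_mx iota Cm = W *m D *m invmx W.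
  apply: (canRL (mulmxK W_unit)).
  by rewrite -[LHS]mulmxA CW -[LHS]mulmxA AV mulmxA PV.
rewrite mxtrace_mulC mulmxA mulVmx // mul1mx /mxtrace.
by apply: eq_bigr => t _; rewrite !mxE eqxx.
Qed.

End Period.

(** The trace is chosen for some primitive root xi', not for the given xi. The two are powers of
    each other, so they have the same Frobenius period. *)
Lemma cyc_traceE m xi o x :
    m.-primitive_root xi -> (0 < o)%N ->
    (forall t, (xi ^+ (q ^ t) == xi) = (o %| t)%N) -> adjoin iota xi x ->
  iota (cyc_trace iota m x) = \sum_(t < o) x ^+ (q ^ t).
Proof.
move=> xi_m o_gt0 xi_o xix.
have [c cx] := trace_exists o_gt0 xi_o xix.
have [xi' xi'_m tr_x] : exists2 xi', m.-primitive_root xi' &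
    is_trace iota xi' x (cyc_trace iota m x).
  by apply: (xgetPex 0 (P := fun t => exists2 xi : L, _ & is_trace iota xi x t));
     exists c, xi.
apply: is_trace_conj tr_x => // t; rewrite -xi_o.
have xi1 := prim_expr_order xi_m.
have [i xi'E] : exists i : 'I_m, xi' = xi ^+ i.
  by have [i ->] := prim_rootP xi_m (prim_expr_order xi'_m); exists i.
have [j xiE] : exists j : 'I_m, xi = xi' ^+ j.
  by have [j ->] := prim_rootP xi'_m xi1; exists j.
by apply/eqP/eqP => h; [rewrite xiE | rewrite xi'E]; rewrite exprAC h.
Qed.

End Frobenius.

(** * Idempotents of characters and their Frobenius orbits *)

Section Characters.
Variables (gT : finGroupType) (L : fieldType) (H : {group gT}) (psi : gT -> L).
Hypothesis psiC : is_char H psi.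

Lemma lchar1 : psi 1%g = 1. Proof. by case: psiC. Qed.

Lemma lcharM : {in H &, {morph psi : x y / (x * y)%g >-> x * y}}.
Proof. by case: psiC. Qed.

Lemma lcharV x : x \in H -> psi x * psi x^-1%g = 1.
Proof. by move=> Hx; rewrite -lcharM ?groupV // mulgV lchar1. Qed.

Lemma lchar_neq0 x : x \in H -> psi x != 0.
Proof.
by move=> /lcharV; apply: contra_eq_neq => ->; rewrite mul0r eq_sym oner_eq0.
Qed.

Lemma lcharX x k : x \in H -> psi (x ^+ k)%g = psi x ^+ k.
Proof.
move=> Hx; elim: k => [|k IHk]; first by rewrite expg0 expr0 lchar1.
by rewrite expgS exprS lcharM ?groupX // IHk.
Qed.

Lemma lchar_exp k : is_char H (fun x => psi x ^+ k).
Proof.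
split=> [|x y Hx Hy]; first by rewrite lchar1 expr1n.
by rewrite lcharM // exprMn.
Qed.

Lemma lchar_eq_gen (A : {set gT}) phi : is_char H phi -> H :=: <<A>>%g ->
  {in A, phi =1 psi} -> {in H, phi =1 psi}.
Proof.
move=> phiC HA eqA.
have grE : group_set [set x in H | phi x == psi x].
  apply/group_setP; split=> [|x y]; rewrite !inE.
    by rewrite group1 lchar1; case: phiC => -> _; apply/eqP.
  move=> /andP[Hx /eqP ex] /andP[Hy /eqP ey]; rewrite groupM //= lcharM //.
  by case: phiC => _ ->; rewrite ?ex ?ey.
suff /subsetP sub : H \subset group grE.
  by move=> x /sub; rewrite inE => /andP[_ /eqP].
apply: (subset_trans (_ : _ \subset <<A>>%g)); first by rewrite -HA.
rewrite gen_subG; apply/subsetP => x Ax; rewrite !inE (eqA x Ax) eqxx andbT.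
by rewrite HA mem_gen.
Qed.

End Characters.

Section CharacterIdempotent.
Variables (L : fieldType) (gT : finGroupType) (G : {group gT}).
Hypothesis G_L : #|G|%:R != 0 :> L.
Local Notation R := (regular_repr L G).

(** For a character psi of H, left multiplication by this element projects onto the elements on
    which H acts from the left through psi. *)
Definition idc (H : {group gT}) (psi : gT -> L) : 'M[L]_#|G| :=
  #|H|%:R^-1 *: \sum_(h in H) psi h^-1%g *: R h.

Lemma idc_ext (H : {group gT}) (psi phi : gT -> L) :
  {in H, psi =1 phi} -> idc H psi = idc H phi.
Proof.
move=> eq_psi; congr (_ *: _); apply: eq_bigr => h Hh.
by rewrite eq_psi ?groupV.
Qed.

Variable H : {group gT}.
Hypothesis sHG : H \subset G.
Let HG h : h \in H -> h \in G. Proof. exact: (subsetP sHG). Qed.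

Lemma sub_card_neq0 : #|H|%:R != 0 :> L.
Proof.
by apply: contraNneq G_L => H0; rewrite -(Lagrange sHG) natrM H0 mul0r.
Qed.

Lemma mul_idc psi h : is_char H psi -> h \in H ->
  R h *m idc H psi = psi h *: idc H psi.
Proof.
move=> psiC Hh; rewrite -scalemxAr scalerA mulrC -scalerA; congr (_ *: _).
rewrite mulmx_sumr scaler_sumr (reindex_inj (mulgI h^-1%g)) /=.
apply: eq_big => [x|x]; first by rewrite groupMl ?groupV.
rewrite groupMl ?groupV // => Hx; rewrite -scalemxAr -repr_mxM ?groupM ?groupV ?HG //.
by rewrite mulKVg invMg invgK (lcharM psiC) ?groupV // scalerA mulrC.
Qed.

Lemma idc_mul psi h : is_char H psi -> h \in H ->
  idc H psi *m R h = psi h *: idc H psi.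
Proof.
move=> psiC Hh; rewrite -scalemxAl scalerA mulrC -scalerA; congr (_ *: _).
rewrite mulmx_suml scaler_sumr (reindex_inj (mulIg h^-1%g)) /=.
apply: eq_big => [x|x]; first by rewrite groupMr ?groupV.
rewrite groupMr ?groupV // => Hx; rewrite -scalemxAl -repr_mxM ?groupM ?groupV ?HG //.
by rewrite mulgKV invMg invgK (lcharM psiC) ?groupV // scalerA.
Qed.

Lemma idc_absorb psi (x : 'M_#|G|) : is_char H psi ->
  (forall h, h \in H -> R h *m x = psi h *: x) -> idc H psi *m x = x.
Proof.
move=> psiC Rx; rewrite -scalemxAl mulmx_suml.
rewrite (eq_bigr (fun _ => x)) => [|h Hh].
  by rewrite sumr_const -scaler_nat scalerA mulVf ?scale1r ?sub_card_neq0.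
by rewrite -scalemxAl Rx // scalerA mulrC (lcharV psiC) // scale1r.
Qed.

Lemma idc_idem psi : is_char H psi -> idc H psi *m idc H psi = idc H psi.
Proof. by move=> psiC; apply: idc_absorb => // h; apply: mul_idc. Qed.

(** An h placed between the two factors can be absorbed by either one, as the scalar psi h or as phi
    h. *)
Lemma idc_orth psi phi h : is_char H psi -> is_char H phi -> h \in H ->
  psi h != phi h -> idc H psi *m idc H phi = 0.
Proof.
move=> psiC phiC Hh neq; apply/eqP.
have: (psi h - phi h) *: (idc H psi *m idc H phi) = 0.
  rewrite scalerBl scalemxAl -(idc_mul psiC) // scalemxAr -(mul_idc phiC) //.
  by rewrite mulmxA subrr.
by move/eqP; rewrite scaler_eq0 subr_eq0 (negPf neq).
Qed.

(** The coefficient of the neutral element is 1/|H|. *)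
Lemma idc_neq0 psi : is_char H psi -> idc H psi != 0.
Proof.
move=> psiC; apply/negP => /eqP/(congr1 (gring_proj (G := G) 1%g)).
rewrite [RHS]linear0 linearZ linear_sum (bigD1 1%g) //= linearZ /=.
rewrite gring_projE // eqxx big1 ?addr0 => [|h /andP[Hh neq]]; last first.
  by rewrite linearZ /= gring_projE ?HG // eq_sym (negPf neq) scaler0.
rewrite invg1 (lchar1 psiC) scale1r => /matrixP/(_ 0 0); rewrite !mxE mulr1.
by move/eqP; rewrite invr_eq0 (negPf sub_card_neq0).
Qed.

Lemma idc_conj psi g : g \in G -> g \in 'N(H) ->
  R g^-1%g *m idc H psi *m R g = idc H (fun x => psi (x ^ g^-1)%g).
Proof.
move=> Gg nHg; rewrite -scalemxAr -scalemxAl; congr (_ *: _).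
rewrite mulmx_sumr mulmx_suml [RHS](reindex_inj (conjg_inj g)) /=.
apply: eq_big => [x|x Hx]; first by rewrite memJ_norm.
rewrite -scalemxAr -scalemxAl -conjVg conjgK.
by rewrite -!repr_mxM ?groupM ?groupV ?(HG Hx) // conjgE mulgA.
Qed.

End CharacterIdempotent.

(** * Idempotents over F attached to Frobenius orbits of characters *)

Section OrbitIdempotent.
Variables (F : finFieldType) (L : closedFieldType) (iota : {rmorphism F -> L}).
Variables (gT : finGroupType) (G : {group gT}).
Hypothesis G_L : #|G|%:R != 0 :> L.
Local Notation q := #|F|.
Local Notation aG := (regular_repr F G).

(* e is the sum of the character idempotents of the q-coset of psi on H, and o is
   the cardinality of this coset. *)
Definition orbit_idem (H : {group gT}) (psi : gT -> L) (e : 'M[F]_#|G|) : Prop :=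
  exists o : nat, [/\ (0 < o)%N,
    forall t, {in H, forall x, psi x ^+ (q ^ t) = psi x} <-> (o %| t)%N
  & map_mx iota e = \sum_(t < o) idc G H (fun x => psi x ^+ (q ^ t))].

Lemma orbit_idem_ext (H : {group gT}) psi phi e : {in H, psi =1 phi} ->
  orbit_idem H psi e -> orbit_idem H phi e.
Proof.
move=> eq_psi [o [o_gt0 oP eE]]; exists o; split=> //.
  move=> t; rewrite -oP; split=> h x Hx; first by rewrite eq_psi ?h // -eq_psi.
  by rewrite -eq_psi ?h.
by rewrite eE; apply: eq_bigr => t _; apply: idc_ext => x Hx; rewrite eq_psi.
Qed.

Variable H : {group gT}.
Hypothesis sHG : H \subset G.
Local Notation same := (@cyc_coset gT L q H).

Lemma same_refl psi : same psi psi.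
Proof. by exists 0%N => x _; rewrite expr1. Qed.

Lemma orbit_idem_mul psi phi e : orbit_idem H psi e ->
    is_char H psi -> is_char H phi -> same psi phi ->
  map_mx iota e *m idc G H phi = idc G H phi /\
  idc G H phi *m map_mx iota e = idc G H phi.
Proof.
case=> o [o_gt0 oP ->] psiC phiC [t phiE].
pose t0 := Ordinal (ltn_pmod t o_gt0).
have phi0 : idc G H phi = idc G H (fun x => psi x ^+ (q ^ t0)).
  apply: idc_ext => x Hx; rewrite phiE //= (frob_mod (o := o)) //; exact: ((oP o).2 (dvdnn o) _ Hx).
(* Exponents below o give distinct characters: Frobenius being injective, an equality at s1 and s2
   makes s1 - s2 a multiple of o. *)
have frob_lt (s1 s2 : nat) : (s2 <= s1)%N -> (s1 < o)%N ->
    (forall x, x \in H -> psi x ^+ (q ^ s1) = psi x ^+ (q ^ s2)) -> s1 = s2.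
  move=> le21 lt1 all_eq; have /(oP _) : {in H, forall x, psi x ^+ (q ^ (s1 - s2)) = psi x}.
    by move=> x Hx; apply: (frob_inj iota (t := s2)); rewrite frobM subnK // all_eq.
  rewrite /dvdn modn_small ?(leq_ltn_trans (leq_subr _ _)) // subn_eq0 => le12.
  by apply/eqP; rewrite eqn_leq le12.
have orth (t1 : 'I_o) : t1 != t0 ->
    exists2 x, x \in H & psi x ^+ (q ^ t1) != psi x ^+ (q ^ t0).
  move=> neq; apply: contrapT => all_eq; move/negP: neq; apply.
  have {}all_eq x : x \in H -> psi x ^+ (q ^ t1) = psi x ^+ (q ^ t0).
    by move=> Hx; apply: contrapT => /eqP ne; apply: all_eq; exists x.
  rewrite -val_eqE; apply/eqP.
  have [le01|/ltnW le10] := leqP t0 t1; first exact: frob_lt (ltn_ord t1) all_eq.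
  by apply/esym/frob_lt; rewrite ?ltn_ord // => x /all_eq.
rewrite phi0 mulmx_suml mulmx_sumr !(bigD1 (P := predT) t0) //=.
have C t1 := lchar_exp psiC (q ^ t1).
rewrite !idc_idem // !big1 ?addr0 // => t1 /orth[x Hx ne].
  by rewrite (idc_orth sHG (C t0) (C t1) Hx) // eq_sym.
by rewrite (idc_orth sHG (C t1) (C t0) Hx).
Qed.

Lemma orbit_idem_mul0 psi phi e : orbit_idem H psi e ->
    is_char H psi -> is_char H phi -> ~ same psi phi ->
  map_mx iota e *m idc G H phi = 0.
Proof.
case=> o [o_gt0 oP ->] psiC phiC not_same.
rewrite mulmx_suml big1 // => t _.
have [x Hx ne] : exists2 x, x \in H & psi x ^+ (q ^ t) != phi x.
  apply: contrapT => all_eq; apply: not_same; exists t => x Hx.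
  by apply: contrapT => /eqP ne; apply: all_eq; exists x; rewrite // eq_sym.
by rewrite (idc_orth sHG (lchar_exp psiC _) phiC Hx).
Qed.

Section Two.
Variables (psi phi : gT -> L) (e f : 'M[F]_#|G|).
Hypotheses (psiC : is_char H psi) (phiC : is_char H phi).
Hypotheses (eO : orbit_idem H psi e) (fO : orbit_idem H phi f).

Lemma same_sym : same psi phi -> same phi psi.
Proof.
(* A power of Frobenius is undone by completing t to the multiple o t of the period. *)
case: eO => o [o_gt0 oP _] [t phiE]; exists (o * t - t)%N => x Hx.
rewrite phiE // frobM subnKC ?leq_pmull // mulnC frob_mul_period //.
exact: ((oP o).2 (dvdnn o) _ Hx).
Qed.

(** The product e f is computed twice: e is a left unit on the summands of f, and f is a right unit
    on those of e. *)
Lemma orbit_idem_eq : same psi phi -> e = f.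
Proof.
move=> spp; have sqq := same_sym spp.
apply: (map_mx_inj (f := iota)).
have mul_l : map_mx iota e *m map_mx iota f = map_mx iota f.
  case: fO => o [_ _ ->]; rewrite mulmx_sumr; apply: eq_bigr => t _.
  apply: (orbit_idem_mul eO psiC (lchar_exp phiC _) _).1.
  by case: spp => s phiE; exists (s + t)%N => x Hx; rewrite phiE // frobM.
rewrite -mul_l; case: eO => o [_ _ ->]; rewrite mulmx_suml; apply: eq_bigr => t _.
rewrite (orbit_idem_mul fO phiC (lchar_exp psiC _) _).2 //.
by case: sqq => s psiE; exists (s + t)%N => x Hx; rewrite psiE // frobM.
Qed.

Lemma orbit_idem_orth : ~ same psi phi -> e *m f = 0.
Proof.
move=> not_same; apply: (map_mx_inj (f := iota)); rewrite map_mxM map_mx0.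
case: (fO) => o [o_gt0 oP ->]; rewrite mulmx_sumr big1 // => t _.
apply: (orbit_idem_mul0 eO psiC (lchar_exp phiC _)) => -[s phiE]; apply: not_same.
exists (s + (o * t - t))%N => x Hx; rewrite -frobM -phiE // frobM.
rewrite subnKC ?leq_pmull // mulnC frob_mul_period //.
exact: ((oP o).2 (dvdnn o) _ Hx).
Qed.

End Two.

Lemma orbit_idem_idem psi e : is_char H psi -> orbit_idem H psi e -> e *m e = e.
Proof.
move=> psiC eO; apply: (map_mx_inj (f := iota)); rewrite map_mxM.
case: (eO) => o [_ _ {2 3}->]; rewrite mulmx_sumr; apply: eq_bigr => t _.
apply: (orbit_idem_mul eO psiC (lchar_exp psiC _) _).1.
by exists t.
Qed.

Lemma orbit_idem_neq0 psi e : is_char H psi -> orbit_idem H psi e -> e != 0.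
Proof.
move=> psiC eO; apply/negP => /eqP e0.
have := (orbit_idem_mul eO psiC psiC (same_refl _)).1.
by rewrite e0 map_mx0 mul0mx => /esym/eqP; rewrite (negPf (idc_neq0 _ _ _)).
Qed.

(** If the cosets differed, e would be orthogonal to itself; but it is a nonzero idempotent. *)
Lemma orbit_idem_same psi phi e : is_char H psi -> is_char H phi ->
  orbit_idem H psi e -> orbit_idem H phi e -> same psi phi.
Proof.
move=> psiC phiC eO eO'; apply: contrapT => ns.
have := orbit_idem_neq0 psiC eO; rewrite -(orbit_idem_idem psiC eO).
by rewrite (orbit_idem_orth psiC phiC eO eO' ns) eqxx.
Qed.

Lemma orbit_idem_conj psi e g : g \in G -> g \in 'N(H) -> orbit_idem H psi e ->
  orbit_idem H (fun x => psi (x ^ g^-1)%g) (aG g^-1%g *m e *m aG g).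
Proof.
move=> Gg nHg [o [o_gt0 oP eE]]; exists o; split=> //.
  move=> t; rewrite -oP; split=> h x Hx; last by rewrite h ?memJ_norm ?groupV.
  by have := h (x ^ g)%g; rewrite conjgK memJ_norm // => ->.
rewrite !map_mxM !map_regular_mx eE mulmx_sumr mulmx_suml; apply: eq_bigr => t _.
by rewrite -(idc_conj sHG (fun x => psi x ^+ (q ^ t))).
Qed.

End OrbitIdempotent.

(** * Unit groups modulo m *)

Section UnitMod.
Variable m : nat.
Hypothesis m_gt0 : (0 < m)%N.

Lemma unit_mod_val k : (1 < m)%N -> coprime m k ->
  FinRing.uval (unit_mod m k) = k%:R.
Proof. by move=> m_gt1 co; rewrite /unit_mod val_insubd unitZpE // co. Qed.

(** The type ['Z_1] has two elements, so modulus 1 is not covered by the computations in ['Z_m] and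
    is treated apart; it still has a single unit, as Z/1 does. This modulus does occur, as 2^0 and
    as an index [H:K]. *)
Lemma unit_Zp1_eq (u v : {unit 'Z_1}) : u = v.
Proof.
have : #|units_Zp_group 1| == 1%N by rewrite card_units_Zp.
by rewrite -trivg_card1 => /eqP/setP E; move: (E u) (E v); rewrite !inE
   => /esym/eqP-> /esym/eqP->.
Qed.

Lemma unit_mod_eq k l : coprime m k -> coprime m l ->
  (unit_mod m k == unit_mod m l) = (k == l %[mod m]).
Proof.
move=> ck cl; have [m_gt1|m_le1] := ltnP 1 m; last first.
  have m1 : m = 1%N by apply/eqP; rewrite eqn_leq m_le1 m_gt0.
  move: (unit_mod m k) (unit_mod m l); rewrite m1 => u v.
  by rewrite (unit_Zp1_eq u v) !modn1 !eqxx.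
rewrite -val_eqE /= !unit_mod_val // -val_eqE /=.
by rewrite !val_Zp_nat.
Qed.

Lemma unit_modM k l : coprime m k -> coprime m l ->
  unit_mod m (k * l) = (unit_mod m k * unit_mod m l)%g.
Proof.
move=> ck cl; have [m_gt1|m_le1] := ltnP 1 m; last first.
  have m1 : m = 1%N by apply/eqP; rewrite eqn_leq m_le1 m_gt0.
  by move: (unit_mod m _) (unit_mod m k) (unit_mod m l); rewrite m1 => *; apply: unit_Zp1_eq.
by apply: val_inj; rewrite /= !unit_mod_val ?coprimeMr ?ck // natrM.
Qed.

Lemma unit_mod1 : unit_mod m 1 = 1%g.
Proof.
have [m_gt1|m_le1] := ltnP 1 m; last first.
  have m1 : m = 1%N by apply/eqP; rewrite eqn_leq m_le1 m_gt0.
  by move: (unit_mod m _); rewrite m1 => *; apply: unit_Zp1_eq.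
by apply: val_inj; rewrite /= unit_mod_val ?coprimen1.
Qed.

Lemma unit_modX k t : coprime m k -> unit_mod m (k ^ t) = (unit_mod m k ^+ t)%g.
Proof.
move=> ck; elim: t => [|t IHt]; first by rewrite expn0 unit_mod1.
by rewrite expnS expgS unit_modM ?coprimeXr // IHt.
Qed.

Lemma order_modP q t : coprime m q ->
  (q ^ t == 1 %[mod m]) = (order_mod m q %| t)%N.
Proof.
move=> cq; rewrite -unit_mod_eq ?coprimen1 ?coprimeXr //.
by rewrite unit_mod1 unit_modX // order_dvdn.
Qed.

End UnitMod.

Lemma order_mod_gt0 m q : (0 < order_mod m q)%N.
Proof. exact: order_gt0. Qed.

(** * The elements eps_C(H,K) as orbit idempotents *)

Section ShodaIdempotent.
Variables (F : finFieldType) (L : closedFieldType) (iota : {rmorphism F -> L}).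
Variables (gT : finGroupType) (G : {group gT}).
Local Notation q := #|F|.
Hypothesis G_q : coprime #|G| q.
Variables (H K : {group gT}) (chi : coset_of K -> L).
Hypotheses (sHG : H \subset G) (nKH : K <| H).
Hypothesis chi_faithful : faithful_char (H / K)%g chi.
Local Notation m := #|H : K|.

Let chiC : is_char (H / K)%G chi. Proof. by case: chi_faithful. Qed.

Let m_q : coprime m q.
Proof. by apply: coprime_dvdl G_q; rewrite (dvdn_trans (dvdn_indexg H K)) ?cardSg. Qed.

(** A finite group that embeds into the multiplicative group of a field is cyclic, so cyclicity of
    H/K comes from the faithful character itself; the order of the generator X is then visible on
    chi X. *)
Lemma faithful_char_generator : exists2 X : coset_of K,
  (H / K)%g = <[X]>%g & m.-primitive_root (chi X).
Proof.
have chi_inj : {in (H / K)%g, forall X, chi X = 1 <-> X = 1%g}.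
  move=> X HX; split=> [X1|->]; last exact: (lchar1 chiC).
  by case: chi_faithful => _; apply=> //; rewrite (lchar1 chiC).
have /cyclicP[X HX] : cyclic (H / K)%G.
  by apply: (field_mul_group_cyclic _ chi_inj); case: chiC.
exists X => //; have XX : X \in (H / K)%g by rewrite HX cycle_id.
have mE : m = #[X]%g by rewrite -card_quotient ?normal_norm // HX.
have Xm : chi X ^+ m = 1 by rewrite -(lcharX chiC) // mE expg_order (lchar1 chiC).
have [m' prim m'm] := prim_order_exists (indexg_gt0 _ _) Xm.
suff <- : m' = m by [].
apply/eqP; rewrite eqn_dvd m'm /= mE order_dvdn; apply/eqP.
by apply/chi_inj; rewrite ?groupX // (lcharX chiC) // (prim_expr_order prim).
Qed.

(** The Frobenius sum that gives the trace is exchanged with the sum over H/K. For each t there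
    remains the idempotent of chi^(q^t) inflated to H. *)
Lemma eps_orbit_idem : orbit_idem iota H (fun x => chi (coset K x)) (eps iota G H chi).
Proof.
have [X HX prim] := faithful_char_generator.
have m_gt0 : (0 < m)%N := indexg_gt0 _ _.
have XX : X \in (H / K)%g by rewrite HX cycle_id.
have xi_o t : (chi X ^+ (q ^ t) == chi X) = (order_mod m q %| t)%N.
  by rewrite -order_modP // -(eq_prim_root_expr prim) expr1.
have chiE Y : Y \in (H / K)%g -> exists i, chi Y = chi X ^+ i.
  by rewrite HX => /cycleP[i ->]; exists i; rewrite (lcharX chiC).
exists (order_mod m q); split=> [||]; first exact: order_mod_gt0.
  move=> t; rewrite -xi_o; split=> [h|/eqP h x Hx].
    by case/morphimP: XX => x _ Hx ->; apply/eqP/h.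
  by have [i ->] := chiE (coset K x) (mem_quotient _ Hx); rewrite exprAC h.
have trE Y : Y \in (H / K)%g ->
    iota (cyc_trace iota m (chi Y)) = \sum_(t < order_mod m q) chi Y ^+ (q ^ t).
  move=> HY; apply: (cyc_traceE prim) => //; first exact: order_mod_gt0.
  by have [i ->] := chiE Y HY; exists 'X^i; rewrite map_polyXn hornerXn.
have step psi : is_char (H / K)%G psi ->
    idc G H (fun x => psi (coset K x)) =
    #|H|%:R^-1 *: (gset_mx L G K *m
       \sum_(Y in (H / K)%g) psi Y *: regular_repr L G (repr Y)^-1%g).
  move=> psiC; congr (_ *: _).
  rewrite (reindex_inj invg_inj) /=.
  under eq_bigl do rewrite groupV.
  rewrite (partition_big (coset K) (mem (H / K)%g)) => [|x Hx]; last exact: mem_quotient.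
  rewrite mulmx_sumr; apply: eq_bigr => Y HY.
  have crY : coset K (repr Y) = Y by rewrite coset_reprK.
  have nH x : x \in H -> x \in 'N(K) by apply: subsetP; apply: normal_norm.
  have HrY : repr Y \in H.
    case/morphimP: HY => y nKy Hy YE.
    have : repr Y \in coset K y by rewrite YE mem_repr_coset.
    rewrite val_coset // => /rcosetP[k Kk ->].
    by rewrite groupM // (subsetP (normal_sub nKH)).
  rewrite -scalemxAr mulmx_suml scaler_sumr.
  (* The coset is enumerated as (repr Y) k^-1 with k in K: the inverse k (repr Y)^-1 then has its
     factor from K on the left, as in [eps]. *)
  rewrite (reindex_inj (inj_comp (mulgI (repr Y)) invg_inj)) /=.
  apply: eq_big => [k|k].
    apply/andP/idP => [[Hk /eqP ck]|Kk].
      move: Hk; rewrite groupMl // groupV => Hk; rewrite -groupV.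
      apply: coset_idr; rewrite ?groupV ?nH //.
      move: ck; rewrite morphM ?groupV ?nH //= crY => ck.
      by apply: (mulgI Y); rewrite mulg1.
    have Hk : k \in H by rewrite (subsetP (normal_sub nKH)).
    by rewrite groupM ?groupV // morphM ?groupV ?nH //= crY coset_id ?groupV // mulg1.
  move=> /andP[Hk /eqP ck]; rewrite invgK ck invMg invgK.
  move: Hk; rewrite groupMl // groupV => Hk.
  by rewrite -repr_mxM ?groupV ?(subsetP sHG).
have toL : map_mx iota (eps iota G H chi) = #|H|%:R^-1 *: (gset_mx L G K *m
    \sum_(Y in (H / K)%g) iota (cyc_trace iota m (chi Y)) *:
       regular_repr L G (repr Y)^-1%g).
  rewrite /eps /hat map_mxZ map_mxM map_mxZ -scalemxAl scalerA !fmorphV !rmorph_nat.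
  rewrite -invfM -natrM mulnC Lagrange ?normal_sub //.
  congr (_ *: (_ *m _)); rewrite map_mx_sum; apply: eq_bigr => x _.
    by rewrite map_regular_mx.
  by rewrite map_mxZ map_regular_mx.
rewrite toL; under eq_bigr => Y HY do rewrite trE // scaler_suml.
rewrite exchange_big mulmx_sumr scaler_sumr; apply: eq_bigr => t _.
by rewrite (step _ (lchar_exp chiC (q ^ t))).
Qed.

End ShodaIdempotent.

(** * Minimal left ideals *)

Section Ideals.
Variables (F : finFieldType) (m n : nat) (A : 'A[F]_(m, n)).
Hypothesis (AM : forall x y, (x \in A)%MS -> (y \in A)%MS -> (x *m y \in A)%MS).

Lemma left_ideal_genP e x :
  reflect (exists2 v, (v \in A)%MS & x = v *m e) (x \in left_ideal_gen A e)%MS.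
Proof.
apply: (iffP mulsmxP) => [[v vA [w wE ->]]|[v vA ->]].
  (* The right factors lie in the line spanned by e, so their scalars can be moved to the left
     factors. *)
  have cE i : exists c, w i = c *: e.
    have /sub_rVP[c cE] := wE i; exists c.
    by rewrite -[w i]mxvecK cE linearZ /= mxvecK; apply: erefl.
  have [c wc] := choice cE.
  exists (\sum_i c i *: v i).
    rewrite linear_sum; apply: summx_sub => i _.
    by rewrite linearZ scalemx_sub ?vA.
  by rewrite mulmx_suml; apply: eq_bigr => i _; rewrite wc -scalemxAr scalemxAl.
have : (v *m e \in left_ideal_gen A e)%MS by apply: mem_mulsmx.
by move/mulsmxP.
Qed.

(** A nonzero left ideal inside A e contains some nonzero v e, hence also w v e = e. *)
Lemma left_ideal_gen_minimal e : (e \in A)%MS -> e *m e = e -> e != 0 ->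
    (forall v, (v \in A)%MS -> v *m e != 0 ->
       exists2 w, (w \in A)%MS & w *m v *m e = e) ->
  minimal_left_ideal A (left_ideal_gen A e).
Proof.
move=> eA ee e_neq0 inv_e; split.
- split.
    apply/memmx_subP => x /left_ideal_genP[v vA ->]; exact: AM.
  apply/mulsmx_subP => x y xA /left_ideal_genP[v vA ->].
  by apply/left_ideal_genP; exists (x *m v); rewrite ?mulmxA ?AM.
- apply/eqP => I0; have : (e \in left_ideal_gen A e)%MS.
    by apply/left_ideal_genP; exists e.
  by rewrite I0 => /memmx0 /eqP; rewrite (negPf e_neq0).
move=> m'' J [JA Jid] JI Jn0.
have [x xJ xn0] : exists2 x, (x \in J)%MS & x != 0.
  apply: contrapT => no; move/eqP: Jn0; apply; apply/row_matrixP => i; rewrite row0.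
  apply: contrapT => /eqP ri; apply: no; exists (vec_mx (row i J)).
    by rewrite vec_mxK row_sub.
  by apply: contraNneq ri => /(congr1 mxvec); rewrite vec_mxK linear0 => ->.
have /left_ideal_genP[v vA xE] : (x \in left_ideal_gen A e)%MS.
  exact: submx_trans JI.
have [w wA we] : exists2 w, (w \in A)%MS & w *m v *m e = e.
  by apply: inv_e; rewrite -?xE.
apply/memmx_subP => y /left_ideal_genP[u uA ->].
rewrite -we -mulmxA -xE mulmxA; move/mulsmx_subP: Jid; apply=> //.
exact: AM.
Qed.

(** If f is nonzero, then f e = f and the hypothesis give w f = e, whence g = e g = w f g = 0. *)
Lemma left_ideal_gen_primitive e : (e \in A)%MS -> e *m e = e -> e != 0 ->
    (forall v, (v \in A)%MS -> v *m e != 0 ->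
       exists2 w, (w \in A)%MS & w *m v *m e = e) ->
  primitive_idempotent A e.
Proof.
move=> eA ee e_neq0 inv_e; split=> // f g [fA ff] [gA gg] fg gf eE.
have fe : f *m e = f by rewrite eE mulmxDr ff fg addr0.
have ge : g *m e = g by rewrite eE mulmxDr gg gf add0r.
have [->|f_neq0] := eqVneq f 0; first by left.
right; have [|w wA we] := inv_e f fA; first by rewrite fe.
have {}we : w *m f = e by rewrite -{1}fe mulmxA.
have eg : e *m g = g by rewrite eE mulmxDl fg add0r gg.
by rewrite -eg -we -mulmxA fg mulmx0.
Qed.

Lemma complete_of_minimal (E : {set 'M[F]_n}) :
    {in E, forall e, [/\ (e \in A)%MS, e *m e = e & e != 0]} ->
    {in E, forall e v, (v \in A)%MS -> v *m e != 0 ->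
       exists2 w, (w \in A)%MS & w *m v *m e = e} ->
    {in E &, forall e f, e != f -> e *m f = 0} ->
    \sum_(e in E) e = 1%:M ->
  complete_primitive_orthogonal A E /\ sum_of_minimal_left_ideals A E.
Proof.
move=> Eidem Einv Eorth Esum; split; split=> //.
- by move=> e Ee; have [eA ee e0] := Eidem e Ee; apply: left_ideal_gen_primitive (Einv e Ee).
- by move=> e Ee; have [eA ee e0] := Eidem e Ee; apply: left_ideal_gen_minimal (Einv e Ee).
- (* mxdirect unfolds left_ideal_gen A e to its definition as a one-term sum. *)
  apply/mxdirect_sumsE; split=> [e _|].
    apply/mxdirect_sumsP => i _; rewrite big_pred0 ?capmx0 // => j.
    by rewrite !ord1.
  apply/mxdirect_sumsP => e Ee; apply/eqP; rewrite -submx0.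
  apply/memmx_subP => x; rewrite sub_capmx => /andP[/left_ideal_genP[v vA xE]].
  case/memmx_sumsP => x_ xsum x_I.
  have [eA ee e0] := Eidem e Ee.
  (* x = x e because x lies in the ideal of e, whereas its components in the other ideals end in
     some f with f e = 0. *)
  suff -> : x = 0 by rewrite linear0 sub0mx.
  have -> : x = x *m e by rewrite xE -mulmxA ee.
  rewrite xsum mulmx_suml big1 // => f /andP[Ef ef].
  have /left_ideal_genP[u uA ->] := x_I f.
  by rewrite -mulmxA (Eorth f e) ?mulmx0.
apply/eqmxP/andP; split.
  apply/sumsmx_subP => e Ee; have [eA ee e0] := Eidem e Ee.
  by apply/memmx_subP => x /left_ideal_genP[v vA ->]; apply: AM.
apply/memmx_subP => x xA; apply/memmx_sumsP.
exists (fun e => x *m (if e \in E then e else 0)).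
  rewrite -{1}[x]mulmx1 -Esum mulmx_sumr; apply: eq_bigr => e Ee.
  by rewrite Ee.
move=> e; case: ifP => Ee; last by rewrite mulmx0 linear0 sub0mx.
by apply/left_ideal_genP; exists x.
Qed.

End Ideals.

(** * The modular group of order 2^(n+1) and its linear characters *)

Section ModularGroup.
Local Open Scope group_scope.
Variables (n : nat) (gT : finGroupType) (G : {group gT}) (a b : gT).
Hypotheses (n_ge3 : (3 <= n)%N) (presG : presented_by_ab G n a b).
Local Notation N := (2 ^ n)%N.
Local Notation s := (2 ^ n.-1)%N.

(** The presentation is the one of the modular group of order 2^(n+1); having the same presentation,
    the two groups are homomorphic images of each other. *)
Lemma card_pres : #|G| = (2 ^ n.+1)%N.
Proof.
case: presG => _ _ _ _ isoG; rewrite -(card_modular_group (p := 2) (n := n.+1)) //.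
have isoM := @Grp_modular_group 2 n.+1 isT (ltnW n_ge3).
have hGM : G \homg 'Mod_(2 ^ n.+1).
  by have := isoM _ G; rewrite /= => ->; apply: isoGrp_hom isoG.
have hMG : 'Mod_(2 ^ n.+1) \homg G.
  by rewrite isoG; apply: isoGrp_hom isoM.
by apply/eqP; rewrite eqn_leq !leq_homg.
  exact: ltnW.
Qed.

Lemma pres_a : a \in G.
Proof. by case: presG => -> _ _ _ _; rewrite mem_gen ?inE ?eqxx. Qed.

Lemma pres_b : b \in G.
Proof. by case: presG => -> _ _ _ _; rewrite mem_gen ?inE ?eqxx ?orbT. Qed.

Let Ga := pres_a.
Let Gb := pres_b.

Lemma sqr_b : b * b = 1. Proof. by case: presG. Qed.

Lemma inv_b : b^-1 = b.
Proof. by apply: (mulgI b); rewrite mulgV sqr_b. Qed.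

Lemma conj_ab x : x \in <[a]> -> x ^ b = x ^+ (1 + s).
Proof.
case/cycleP => i ->; case: presG => _ _ _ ab _.
by rewrite conjXg ab -!expgM mulnC.
Qed.

Lemma norm_cycle_b : b \in 'N(<[a]>).
Proof.
case: presG => _ _ _ ab _.
by rewrite inE -cycleJ ab cycle_subG mem_cycle.
Qed.

Lemma cycle_ab : G :=: <[a]> * <[b]>.
Proof.
case: presG => -> _ _ _ _; rewrite -norm_joinEr ?cycle_subG ?norm_cycle_b //.
by rewrite joing_idl joing_idr.
Qed.

Lemma mem_cycle_b x : x \in <[b]> -> x = 1 \/ x = b.
Proof.
case/cycleP => i ->; rewrite -(odd_double_half i) expgD -mul2n expgM [b ^+ 2]sqr_b.
by rewrite expg1n mulg1; case: odd; [right | left].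
Qed.

Lemma pres_cases g : g \in G -> g \in <[a]> \/ g * b \in <[a]>.
Proof.
rewrite cycle_ab => /mulsgP[x y ax /mem_cycle_b[] -> ->]; first by left; rewrite mulg1.
by right; rewrite -mulgA sqr_b mulg1.
Qed.

(** The relations bound the order from above. The bound from below is |G| <= |<a>| |<b>| with |G| =
    2^(n+1) and |<b>| <= 2. *)
Lemma order_a : #[a] = N.
Proof.
case: presG => _ aN _ _ _; apply/eqP; rewrite eqn_leq dvdn_leq ?expn_gt0 //=; last first.
  by rewrite order_dvdn aN.
have ob : (#|<[b]>| <= 2)%N.
  by rewrite dvdn_leq // order_dvdn expgS expg1 sqr_b.
have : (#|G| <= #[a] * 2)%N.
  rewrite (leq_trans (_ : _ <= #|<[a]>| * #|<[b]>|)%N) ?leq_mul2l ?ob ?orbT //.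
  by rewrite cycle_ab mul_cardG leq_pmulr ?cardG_gt0.
by rewrite card_pres expnS mulnC leq_pmul2r.
Qed.

Lemma b_notin : b \notin <[a]>.
Proof.
apply/negP => ab; have : (#|G| <= #[a])%N.
  apply/subset_leq_card; case: presG => -> _ _ _ _.
  by rewrite gen_subG subUset !sub1set cycle_id ab.
by rewrite card_pres order_a leqNgt ltn_exp2l // ltnSn.
Qed.

Lemma pres_notin g : g \in G -> g \notin <[a]> -> g * b \in <[a]>.
Proof. by move=> /pres_cases[->|]. Qed.

Lemma mul_cycle_b x : x \in <[a]> -> x * b \notin <[a]>.
Proof. by move=> ax; rewrite groupMl // b_notin. Qed.

Lemma cycle_a_sub : <[a]> \subset G. Proof. by rewrite cycle_subG. Qed.

Lemma cycle_a_normal : <[a]> <| G.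
Proof.
rewrite /normal cycle_a_sub /= cycle_ab mul_subG ?normG //.
by rewrite cycle_subG norm_cycle_b.
Qed.

Section LinearCharacters.
Local Open Scope ring_scope.
Variables (L : fieldType) (gamma : gT -> L).
Hypothesis gamma_faithful : faithful_char <[a]> gamma.
Local Notation w := (gamma a).

Lemma gamma_char : is_char <[a]>%G gamma. Proof. by case: gamma_faithful. Qed.

Lemma gamma_prim : N.-primitive_root w.
Proof.
have wN : w ^+ N = 1.
  rewrite -(lcharX gamma_char) ?cycle_id // -order_a expg_order.
  by rewrite (lchar1 gamma_char).
have N_gt0 : (0 < N)%N by rewrite expn_gt0.
have [m prim mN] := prim_order_exists N_gt0 wN.
suff <- : m = N by [].
apply/eqP; rewrite eqn_dvd mN -order_a order_dvdn; apply/eqP.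
case: gamma_faithful => _; apply; rewrite ?groupX ?cycle_id //.
rewrite (lcharX gamma_char) ?cycle_id // (prim_expr_order prim).
by rewrite (lchar1 gamma_char).
Qed.

(** w^s is a square root of 1 different from 1, as w has order 2s. Every parity argument about
    exponents rests on this. *)
Lemma exp_half k : w ^+ (k * s) = (-1) ^+ k.
Proof.
suff ws : w ^+ s = -1 by rewrite mulnC exprM ws.
have prim := gamma_prim.
have : (w ^+ s) ^+ 2 == 1.
  by rewrite -exprM -expnSr prednK ?(prim_expr_order prim) // (leq_trans _ n_ge3).
rewrite sqrf_eq1 => /orP[|/eqP //]; rewrite -(prim_order_dvd prim).
move/dvdn_leq; rewrite expn_gt0 => /(_ isT); rewrite leq_exp2l //.
by rewrite leqNgt prednK ?leqnn // (leq_trans _ n_ge3).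
Qed.

Lemma neg1_neq1 : (-1 : L) != 1.
Proof.
have n0 : (0 < n)%N by apply: leq_trans n_ge3.
have prim := gamma_prim.
rewrite -(expr1 (-1)) -exp_half mul1n -(prim_order_dvd prim) gtnNdvd ?expn_gt0 //.
by rewrite ltn_exp2l // prednK.
Qed.

Lemma signr_inj (e e' : bool) : (-1 : L) ^+ e = (-1) ^+ e' -> e = e'.
Proof.
by case: e e' => [] [] //=; rewrite expr1 expr0 => /eqP;
  rewrite ?(negPf neg1_neq1) // eq_sym (negPf neg1_neq1).
Qed.

(** For l even, the linear character of G with a sent to w^l and b to (-1)^e; an element g outside
    <a> is written (g b) b with g b in <a>. *)
Definition lin (l : nat) (e : bool) (g : gT) : L :=
  if g \in <[a]> then gamma g ^+ l else (-1) ^+ e * gamma (g * b)%g ^+ l.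

Lemma lin_a l e : lin l e a = w ^+ l.
Proof. by rewrite /lin cycle_id. Qed.

Lemma lin_b l e : lin l e b = (-1) ^+ e.
Proof.
by rewrite /lin (negPf b_notin) sqr_b (lchar1 gamma_char) expr1n mulr1.
Qed.

(** x^b = x x^s, and for l even the factor gamma(x^s)^l is an even power of -1. *)
Lemma gamma_conj l x : ~~ odd l -> x \in <[a]> -> gamma (x ^ b)%g ^+ l = gamma x ^+ l.
Proof.
move=> l_even ax; rewrite conj_ab // (lcharX gamma_char) // -exprM mulnDl mul1n exprD.
have /cycleP[i ->] := ax; rewrite (lcharX gamma_char) ?cycle_id // -!exprM.
rewrite [(s * l)%N]mulnC mulnA exp_half -signr_odd oddM (negPf l_even) andbF.
by rewrite mulr1.
Qed.

Lemma lin_char l e : ~~ odd l -> is_char G (lin l e).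
Proof.
move=> l_even; split; first by rewrite /lin group1 (lchar1 gamma_char) expr1n.
have gM := lcharM gamma_char; have gc x := @gamma_conj l x l_even.
have aJ x : x \in <[a]> -> (x ^ b)%g \in <[a]> by rewrite memJ_norm ?norm_cycle_b.
move=> g h Gg Gh; rewrite /lin.
case: ifPn => [agh|nagh]; case: ifPn => [ag|nag]; case: ifPn => [ah|nah].
- by rewrite gM // exprMn.
- by move: agh; rewrite groupMl // (negPf nah).
- by move: agh; rewrite groupMr // (negPf nag).
- have agb := pres_notin Gg nag; have ahb := pres_notin Gh nah.
  have -> : (g * h = (g * b) * ((h * b) ^ b))%g.
    by rewrite conjgE mulgA mulgK -[(h * b * b)%g]mulgA sqr_b mulg1.
  by rewrite (gM (g * b)%g) ?aJ // exprMn gc // mulrACA -signr_addb addbb mul1r.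
- by move: nagh; rewrite groupM.
- by rewrite -mulgA (gM g) ?pres_notin // exprMn mulrCA.
- have agb := pres_notin Gg nag.
  have -> : (g * h * b = (g * b) * (h ^ b))%g.
    by rewrite conjgE mulgA mulgK mulgA.
  by rewrite (gM (g * b)%g) ?aJ // exprMn gc // mulrA.
- have agb := pres_notin Gg nag; have ahb := pres_notin Gh nah.
  move: nagh; have -> : (g * h = (g * b) * ((h * b) ^ b))%g.
    by rewrite conjgE mulgA mulgK -[(h * b * b)%g]mulgA sqr_b mulg1.
  by rewrite groupM ?aJ.
Qed.

Lemma lin_ext psi : is_char G psi -> forall l (e : bool), ~~ odd l ->
  psi a = w ^+ l -> psi b = (-1) ^+ e -> {in G, psi =1 lin l e}.
Proof.
move=> psiC l e l_even pa pb; case: presG => GE _ _ _ _.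
apply: (lchar_eq_gen (lin_char e l_even) psiC GE) => x.
by rewrite !inE => /orP[/eqP->|/eqP->]; rewrite ?lin_a ?lin_b.
Qed.

(** A linear character takes the same value on a and a^b = a a^s, so psi(a)^s = 1. With psi(a) = w^l
    this reads (-1)^l = 1 and forces l even. *)
Lemma lin_surj psi : is_char G psi ->
  exists l e, [/\ ~~ odd l, (l < N)%N & {in G, psi =1 lin l e}].
Proof.
move=> psiC; have pX := lcharX psiC; have prim := gamma_prim.
have paN : psi a ^+ N = 1 by rewrite -pX // -order_a expg_order (lchar1 psiC).
have [l paE] := prim_rootP prim paN.
have pbE : exists e : bool, psi b = (-1) ^+ e.
  have : psi b ^+ 2 == 1 by rewrite -pX // expgS expg1 sqr_b (lchar1 psiC).
  by rewrite sqrf_eq1 => /orP[]/eqP ->; [exists false | exists true].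
have [e pb] := pbE.
have l_even : ~~ odd l.
  apply/negP => l_odd; have /eqP := neg1_neq1; apply.
  have -> : (-1 : L) = w ^+ (l * s) by rewrite exp_half -signr_odd l_odd.
  rewrite exprM -paE -pX //; apply: (mulfI (lchar_neq0 psiC Ga)); rewrite mulr1.
  rewrite -(lcharM psiC) ?groupX // -expgS -add1n -conj_ab ?cycle_id //.
  by rewrite conjgE !(lcharM psiC) ?groupM ?groupV // mulrC mulrAC -mulrA
    [psi b^-1%g * _]mulrC (lcharV psiC) // mulr1.
by exists l, e; split=> //; apply: lin_ext.
Qed.

End LinearCharacters.
End ModularGroup.

(** * The listed subgroups as kernels of linear characters *)

Section Kernels.
Variables (n : nat) (gT : finGroupType) (G : {group gT}) (a b : gT).
Hypotheses (n_ge3 : (3 <= n)%N) (presG : presented_by_ab G n a b).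
Local Notation N := (2 ^ n)%N.
Variables (L : fieldType) (gamma : gT -> L).
Hypothesis gamma_faithful : faithful_char <[a]> gamma.
Local Notation w := (gamma a).
Local Notation lin := (lin a b gamma).

Let Ga := pres_a presG.
Let Gb := pres_b presG.

Lemma even_exp j : (j < n)%N -> ~~ odd (2 ^ (n - j)).
Proof. by move=> jn; rewrite oddX /= orbF subn_eq0 -ltnNge. Qed.

Lemma commute_even i : ~~ odd i -> commute (a ^+ i)%g b.
Proof.
move=> i_even; apply/commgP/conjg_fixP.
rewrite (conj_ab presG) ?mem_cycle // expgD expg1 -expgM.
rewrite -(odd_double_half i) (negPf i_even) add0n -mul2n mulnAC -expnS.
rewrite prednK ?(leq_trans _ n_ge3) // expgM.
by case: presG => _ -> _ _ _; rewrite expg1n mulg1.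
Qed.

(** Indexed so that the group is the kernel of the character sending a to a primitive 2^j-th root of
    unity and b to (-1)^e; j = 0 and j = 1 give the four groups at the head of the list. *)
Definition shoda_kernel (j : nat) (e : bool) : {group gT} :=
  (if e then
     match j with
     | 0 => <[a]>
     | 1 => <<[set (a ^+ 2)%g; (a * b)%g]>>
     | _ => <[(a ^+ (2 ^ j.-1) * b)%g]>
     end
   else
     match j with
     | 0 => G
     | 1 => <<[set (a ^+ 2)%g; b]>>
     | _ => <<[set (a ^+ (2 ^ j))%g; b]>>
     end)%G.

Lemma shoda_kernelsP (K : {group gT}) :
  K \in shoda_kernels G n a b <-> exists j e, (j < n)%N /\ K = shoda_kernel j e.
Proof.
split=> [|[j [e [jn ->]]]].
  rewrite mem_cat !inE => /orP[|/flattenP[Ks /mapP[j]]].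
    case/or4P=> /eqP->.
    - by exists 0%N, false; split; first exact: leq_trans n_ge3.
    - by exists 0%N, true; split; first exact: leq_trans n_ge3.
    - by exists 1%N, false; split; first exact: leq_trans n_ge3.
    - by exists 1%N, true; split; first exact: leq_trans n_ge3.
  rewrite mem_index_iota => /andP[j_ge2 jn] ->; rewrite !inE.
  by case/orP=> /eqP->; [exists j, false | exists j, true]; split=> //;
    case: j j_ge2 {jn} => [|[|j]].
rewrite mem_cat; case: j jn => [|[|j]] jn.
- by case: e; rewrite !inE eqxx ?orbT.
- by case: e; rewrite !inE eqxx ?orbT.
apply/orP; right; apply/flattenP.
exists [:: shoda_kernel j.+2 false; shoda_kernel j.+2 true].
  by apply/mapP; exists j.+2; rewrite // mem_index_iota jn.
by case: e; rewrite !inE eqxx ?orbT.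
Qed.

Lemma root_prim j : (j <= n)%N -> (2 ^ j).-primitive_root (w ^+ (2 ^ (n - j))).
Proof.
move=> jn; have prim := gamma_prim n_ge3 presG gamma_faithful.
by rewrite expnB // dvdn_prim_root // dvdn_exp2l.
Qed.

Lemma root_half j : (0 < j <= n)%N -> w ^+ (2 ^ (n - j)) ^+ (2 ^ j.-1) = -1.
Proof.
case/andP=> j_gt0 jn; rewrite -exprM -expnD.
have -> : (n - j + j.-1 = n.-1)%N.
  by apply: succn_inj; rewrite -addnS !prednK ?subnK // (leq_trans _ n_ge3).
by rewrite -[(2 ^ _)%N]mul1n (exp_half n_ge3 presG gamma_faithful).
Qed.

Lemma lin_expa l e i : lin l e (a ^+ i)%g = w ^+ l ^+ i.
Proof.
rewrite /lin mem_cycle (lcharX (gamma_char gamma_faithful)) ?cycle_id //.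
by rewrite exprAC.
Qed.

Lemma lin_expab l e i : lin l e (a ^+ i * b)%g = (-1) ^+ e * w ^+ l ^+ i.
Proof.
rewrite /lin (negPf (mul_cycle_b n_ge3 presG (mem_cycle a i))).
rewrite -mulgA (sqr_b presG) mulg1.
by rewrite (lcharX (gamma_char gamma_faithful)) ?cycle_id // exprAC.
Qed.

Lemma pres_forms g : g \in G ->
  (exists i, g = a ^+ i)%g \/ (exists i, g = a ^+ i * b)%g.
Proof.
case/(pres_cases presG) => /cycleP[i gE]; [left | right]; exists i => //.
by rewrite -gE -mulgA (sqr_b presG) mulg1.
Qed.

Lemma lin_ker_gen (A : {set gT}) l e : ~~ odd l -> A \subset G ->
    {in A, forall x, lin l e x = 1} ->
    (forall i, w ^+ l ^+ i = 1 -> (a ^+ i)%g \in <<A>>%g) ->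
    (forall i, (-1) ^+ e * w ^+ l ^+ i = 1 -> (a ^+ i * b)%g \in <<A>>%g) ->
  forall g, (g \in <<A>>%g) = (g \in G) && (lin l e g == 1).
Proof.
move=> l_even sAG A1 inA inAb g; have lC := lin_char n_ge3 presG gamma_faithful e l_even.
have ker_set : group_set [set x in G | lin l e x == 1].
  apply/group_setP; split=> [|x y]; rewrite !inE ?group1 ?(lchar1 lC) ?eqxx //.
  move=> /andP[Gx /eqP x1] /andP[Gy /eqP y1].
  by rewrite groupM //= (lcharM lC) // x1 y1 mulr1.
apply/idP/andP=> [|[Gg /eqP]].
  have /subsetP sub : <<A>>%g \subset group ker_set.
    rewrite gen_subG; apply/subsetP => x Ax.
    by rewrite !inE (subsetP sAG) ?A1 ?eqxx.
  by move/sub; rewrite inE => /andP.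
by have [[i ->]|[i ->]] := pres_forms Gg; rewrite ?lin_expa ?lin_expab; auto.
Qed.

Lemma shoda_kernelE j e : (j < n)%N ->
  forall g, (g \in shoda_kernel j e) = (g \in G) && (lin (2 ^ (n - j)) e g == 1).
Proof.
move=> jn; have l_even := even_exp jn.
have prim := root_prim (ltnW jn).
have root_dvd i : w ^+ (2 ^ (n - j)) ^+ i = 1 -> exists k, (a ^+ i = (a ^+ (2 ^ j)) ^+ k)%g.
  by move/eqP; rewrite -(prim_order_dvd prim) => /dvdnP[k ->]; exists k; rewrite -expgM mulnC.
have lin1 f : lin (2 ^ (n - j)) f (a ^+ (2 ^ j))%g = 1.
  by rewrite lin_expa (prim_expr_order prim).
have gA (A : {set gT}) i : (a ^+ (2 ^ j))%g \in A -> w ^+ (2 ^ (n - j)) ^+ i = 1 ->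
    (a ^+ i)%g \in <<A>>%g.
  by move=> Aa /root_dvd[k ->]; rewrite groupX // mem_gen.
case: e.
  case: j => [|j] in jn l_even prim root_dvd lin1 gA *.
    apply: lin_ker_gen => //; first by rewrite sub1set.
    - by move=> x /set1P->; have := lin1 true; rewrite expn0 expg1.
    - by move=> i _; rewrite mem_cycle.
    move=> i /eqP; rewrite subn0 (prim_expr_order (gamma_prim n_ge3 presG gamma_faithful)).
    by rewrite expr1n mulr1 expr1 (negPf (neg1_neq1 n_ge3 presG gamma_faithful)).
  have KE g : (g \in <<[set (a ^+ (2 ^ j.+1))%g; (a ^+ (2 ^ j) * b)%g]>>%g) =
      (g \in G) && (lin (2 ^ (n - j.+1)) true g == 1).
    have half : w ^+ (2 ^ (n - j.+1)) ^+ (2 ^ j) = -1 by exact: (@root_half j.+1 (ltnW jn)).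
    apply: lin_ker_gen => //.
    - by rewrite subUset !sub1set groupM ?groupX.
    - move=> x /set2P[]-> //; rewrite lin_expab half expr1.
      by rewrite mulrNN mulr1.
    - by move=> i; apply: gA; rewrite !inE eqxx.
    (* As -1 is the 2^j-th power of a root of order 2^(j+1), the condition says that i is congruent
       to 2^j modulo 2^(j+1). *)
    move=> i; rewrite expr1 mulN1r => /eqP; rewrite eqr_oppLR -half.
    rewrite (eq_prim_root_expr prim) [X in _ == X]modn_small ?ltn_exp2l // => /eqP im.
    rewrite (divn_eq i (2 ^ j.+1)) im expgD -mulgA [(_ %/ _ * _)%N]mulnC expgM.
    by apply: groupM; [apply: groupX|]; apply: mem_gen; rewrite !inE eqxx ?orbT.
  case: j => [|j] in jn l_even prim root_dvd lin1 gA KE *; first exact: KE.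
  move=> g; rewrite -KE; suff <- : <[(a ^+ (2 ^ j.+1) * b)%g]> =
    <<[set (a ^+ (2 ^ j.+2))%g; (a ^+ (2 ^ j.+1) * b)%g]>>%g by [].
  apply/eqP; rewrite eqEsubset cycle_subG mem_gen ?inE ?eqxx ?orbT //=.
  rewrite gen_subG subUset !sub1set cycle_id andbT.
  (* a^(2^(j+1)) has an even exponent and so commutes with b; hence the square of the second
     generator is the first. *)
  apply/cycleP; exists 2; rewrite expgS expg1 mulgA -[(_ * b * _)%g]mulgA.
  have evenj : ~~ odd (2 ^ j.+1) by rewrite oddX.
  rewrite -(commute_even evenj) mulgA -!mulgA (sqr_b presG) mulg1 -expgD.
  by rewrite addnn -mul2n -expnS.
have KE g : (g \in <<[set (a ^+ (2 ^ j))%g; b]>>%g) =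
    (g \in G) && (lin (2 ^ (n - j)) false g == 1).
  apply: lin_ker_gen => //.
  - by rewrite subUset !sub1set Gb groupX.
  - by move=> x /set2P[]-> //; rewrite (lin_b n_ge3 presG gamma_faithful).
  - by move=> i; apply: gA; rewrite !inE eqxx.
  move=> i; rewrite expr0 mul1r => i1.
  by apply: groupM; [apply: gA => //|apply: mem_gen]; rewrite !inE eqxx ?orbT.
case: j => [|[|j]] in KE jn {l_even prim root_dvd lin1 gA} *; [|exact: KE|exact: KE].
by move=> g; rewrite -KE expn0 expg1; case: presG => <-.
Qed.

Lemma shoda_kernel_normal j e : (j < n)%N -> shoda_kernel j e <| G.
Proof.
move=> jn; have lC := lin_char n_ge3 presG gamma_faithful e (even_exp jn).
rewrite /normal; apply/andP; split.
  by apply/subsetP => g; rewrite shoda_kernelE // => /andP[].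
apply/subsetP => x Gx; rewrite inE; apply/subsetP => g.
rewrite mem_conjg !shoda_kernelE // groupJr ?groupV //.
move=> /andP[Gg /eqP <-]; rewrite Gg /=; apply/eqP.
rewrite conjgE invgK !(lcharM lC) ?groupM ?groupV // mulrCA.
by rewrite (lcharV lC) // mulr1.
Qed.

Lemma lin_mul_exp l (e : bool) u g : odd u -> lin (l * u) e g = lin l e g ^+ u.
Proof.
move=> u_odd; rewrite /lin; case: ifP => _; first by rewrite exprM.
rewrite exprMn -!exprM; congr (_ * _).
by rewrite mulnC exprM -[(-1) ^+ u]signr_odd u_odd.
Qed.

(** Here u is the odd part of l and n - j its 2-adic valuation. If N divides l, in particular for l
    = 0, the value at a is 1 and j = 0, u = 1 are taken. *)
Lemma lin_odd_part l e : ~~ odd l -> exists j u,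
  [/\ (j < n)%N, odd u & {in G, lin l e =1 lin (2 ^ (n - j) * u) e}].
Proof.
move=> l_even; have prim := gamma_prim n_ge3 presG gamma_faithful.
have lC := lin_char n_ge3 presG gamma_faithful e l_even.
suff [j [u [jn u_odd wE]]] : exists j u, [/\ (j < n)%N, odd u & w ^+ l = w ^+ (2 ^ (n - j) * u)].
  exists j, u; split=> //; apply: (lin_ext n_ge3 presG gamma_faithful lC).
  - by rewrite oddM (negPf (even_exp jn)).
  - by rewrite lin_a wE.
  - by rewrite (lin_b n_ge3 presG gamma_faithful).
have [Nl|Nl] := boolP (N %| l)%N.
  exists 0%N, 1%N; split; rewrite ?(leq_trans _ n_ge3) //.
  rewrite muln1 subn0 (prim_expr_order prim).
  by apply/eqP; rewrite -(prim_order_dvd prim).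
have l_gt0 : (0 < l)%N by case: l Nl {l_even lC}; rewrite ?dvdn0.
have [u cu lE] := pfactor_coprime (isT : prime 2) l_gt0.
move: cu; rewrite coprime2n => u_odd.
have lt_n : (logn 2 l < n)%N.
  by rewrite ltnNge; apply: contra Nl; rewrite pfactor_dvdn.
have lo_gt0 : (0 < logn 2 l)%N.
  by move: l_even; rewrite {1}lE oddM u_odd oddX; case: logn.
exists (n - logn 2 l)%N, u; split=> //.
  by rewrite ltn_subrL lo_gt0 (leq_trans _ n_ge3).
by rewrite subKn 1?mulnC -?lE // ltnW.
Qed.

End Kernels.

(** * Central idempotents *)

Section GroupRing.
Variables (F : finFieldType) (L : closedFieldType) (iota : {rmorphism F -> L}).
Variables (gT : finGroupType) (G : {group gT}).
Local Notation aG := (regular_repr F G).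
Local Notation FG := (group_ring F G).

Lemma group_ring1 : (1%:M \in FG)%MS. Proof. exact: envelop_mx1. Qed.

Lemma group_ringM x y : (x \in FG)%MS -> (y \in FG)%MS -> (x *m y \in FG)%MS.
Proof. exact: envelop_mxM. Qed.

Lemma group_ringG g : g \in G -> (aG g \in FG)%MS.
Proof. exact: envelop_mx_id. Qed.

Lemma group_ringZ c x : (x \in FG)%MS -> (c *: x \in FG)%MS.
Proof. by move=> xA; rewrite linearZ scalemx_sub. Qed.

Lemma group_ringD x y : (x \in FG)%MS -> (y \in FG)%MS -> (x + y \in FG)%MS.
Proof. by move=> xA yA; rewrite linearD addmx_sub. Qed.

Lemma group_ring_sum (I : Type) (r : seq I) (P : pred I) (x : I -> 'M[F]_#|G|) :
  (forall i, P i -> x i \in FG)%MS -> (\sum_(i <- r | P i) x i \in FG)%MS.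
Proof. by move=> xA; rewrite linear_sum summx_sub. Qed.

Lemma hat_mem (X : {set gT}) : X \subset G -> (hat F G X \in FG)%MS.
Proof.
move=> sXG; apply/group_ringZ/group_ring_sum => x Xx.
by rewrite group_ringG ?(subsetP sXG).
Qed.

Lemma eps_mem (H K : {group gT}) (chi : coset_of K -> L) :
  H \subset G -> K <| H -> (eps iota G H chi \in FG)%MS.
Proof.
move=> sHG nKH; apply/group_ringZ/group_ringM.
  by apply/hat_mem/(subset_trans (normal_sub nKH)).
apply: group_ring_sum => X HX; apply/group_ringZ/group_ringG; rewrite groupV.
case/morphimP: HX => y nKy Hy XE; apply: (subsetP sHG).
have : repr X \in coset K y by rewrite XE mem_repr_coset.
rewrite val_coset // => /rcosetP[k Kk ->].
by rewrite groupM // (subsetP (normal_sub nKH)).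
Qed.

Lemma group_ring_comm e : (forall g, g \in G -> aG g *m e = e *m aG g) ->
  forall x, (x \in FG)%MS -> x *m e = e *m x.
Proof.
move=> comm x /envelop_mxP[c ->]; rewrite mulmx_suml mulmx_sumr.
by apply: eq_bigr => g Gg; rewrite -scalemxAl comm // scalemxAr.
Qed.

Lemma eC_of_central (K : {group gT}) (chi : coset_of K -> L) :
  (forall g, g \in G -> aG g *m eps iota G G chi = eps iota G G chi *m aG g) ->
  eC iota G G chi = eps iota G G chi.
Proof.
move=> comm; rewrite /eC (_ : [set _ | g in G] = [set eps iota G G chi]) ?big_set1 //.
apply/setP => x; rewrite inE; apply/imsetP/eqP => [[g Gg ->]|->].
  by rewrite -mulmxA -comm // mulmxA -repr_mxM ?groupV // mulVg repr_mx1 mul1mx.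
by exists 1%g; rewrite // invg1 repr_mx1 mul1mx mulmx1.
Qed.

Lemma orbit_idem_central psi e : is_char G psi -> orbit_idem iota G psi e ->
  forall g, g \in G -> aG g *m e = e *m aG g.
Proof.
move=> psiC [o [_ _ eE]] g Gg; apply: (map_mx_inj (f := iota)).
rewrite !map_mxM map_regular_mx eE mulmx_sumr mulmx_suml; apply: eq_bigr => t _.
by have C := lchar_exp psiC (#|F| ^ t); rewrite (mul_idc _ C) // (idc_mul _ C).
Qed.

End GroupRing.

Section Central.
Variables (F : finFieldType) (L : closedFieldType) (iota : {rmorphism F -> L}).
Variables (n : nat) (gT : finGroupType) (G : {group gT}) (a b : gT).
Hypotheses (n_ge3 : (3 <= n)%N) (presG : presented_by_ab G n a b).
Hypothesis (q_odd : odd #|F|).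
Variables (gamma : gT -> L).
Hypothesis gamma_faithful : faithful_char <[a]> gamma.
Local Notation N := (2 ^ n)%N.
Local Notation q := #|F|.
Local Notation lin := (lin a b gamma).
Local Notation E1 := (central_part iota G n a b).

Lemma two_neq0 : 2%:R != 0 :> L.
Proof.
have := prim_root_natf_neq0 (gamma_prim n_ge3 presG gamma_faithful).
by rewrite natrX; apply: contraNneq => ->; rewrite expr0n; case: n n_ge3.
Qed.

Lemma card_pres_neq0 : #|G|%:R != 0 :> L.
Proof. by rewrite (card_pres n_ge3 presG) natrX expf_neq0 ?two_neq0. Qed.

Lemma coprime_2X_q j : coprime (2 ^ j) q.
Proof. by rewrite coprimeXl // coprime2n. Qed.

Lemma coprime_pres_q : coprime #|G| q.
Proof. by rewrite (card_pres n_ge3 presG) coprime_2X_q. Qed.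

(** On G, psi is the u-th power of the character with kernel K, u odd. Values on G have 2-power
    order, so the odd power does not enlarge the kernel, and psi descends to a faithful character of
    G/K. *)
Lemma central_part_of_char psi : is_char G psi -> exists2 e, e \in E1 & orbit_idem iota G psi e.
Proof.
move=> psiC.
have [l [e [l_even _ psiE]]] := lin_surj n_ge3 presG gamma_faithful psiC.
have [j [u [jn u_odd linE]]] := lin_odd_part n_ge3 presG gamma_faithful e l_even.
pose K := shoda_kernel G a b j e.
have nKG : K <| G := shoda_kernel_normal n_ge3 presG gamma_faithful e jn.
have lC := lin_char n_ge3 presG gamma_faithful e (even_exp jn).
have KE g : g \in G -> (g \in K) = (psi g == 1).
  move=> Gg; rewrite (shoda_kernelE n_ge3 presG gamma_faithful e jn) Gg /=.
  rewrite psiE // linE // lin_mul_exp //.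
  set x := lin _ _ g; apply/eqP/eqP => [->|xu]; first by rewrite expr1n.
  have xN : x ^+ (2 ^ n.+1) = 1.
    by rewrite -(card_pres n_ge3 presG) -(lcharX lC) // expg_cardG // (lchar1 lC).
  have co : coprime u (2 ^ n.+1) by rewrite coprimeXr // coprimen2.
  have : x ^+ gcdn u (2 ^ n.+1) == 1.
    have [m prim mu] := prim_order_exists (odd_gt0 u_odd) xu.
    by rewrite -(prim_order_dvd prim) dvdn_gcd mu (prim_order_dvd prim) xN eqxx.
  by rewrite (eqP co) expr1 => /eqP.
have psi_repr g : g \in G -> psi (repr (coset K g)) = psi g.
  move=> Gg; have nKg := subsetP (normal_norm nKG) g Gg.
  have : repr (coset K g) \in coset K g by apply: mem_repr_coset.
  rewrite val_coset // => /rcosetP[k Kk ->].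
  have Gk := subsetP (normal_sub nKG) k Kk.
  by rewrite (lcharM psiC) //; move: Kk; rewrite KE // => /eqP->; rewrite mul1r.
pose chi (X : coset_of K) := psi (repr X).
have chi_faithful : faithful_char (G / K)%g chi.
  split; first split.
  - by rewrite /chi -(coset_id (group1 K)) psi_repr // (lchar1 psiC).
  - move=> _ _ /morphimP[x nKx Gx ->] /morphimP[y nKy Gy ->].
    by rewrite -morphM // /chi !psi_repr ?groupM // (lcharM psiC).
  move=> _ _ /morphimP[x nKx Gx ->] /morphimP[y nKy Gy ->].
  rewrite /chi !psi_repr // => xy; apply/eqP; rewrite eq_mulgV1 -morphV // -morphM ?groupV //.
  apply/eqP/coset_id; rewrite KE ?groupM ?groupV // (lcharM psiC) ?groupV // xy.
  by rewrite (lcharV psiC).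
have eO : orbit_idem iota G psi (eps iota G G chi).
  have := eps_orbit_idem iota coprime_pres_q (subxx G) nKG chi_faithful.
  by apply: orbit_idem_ext => x Gx; apply: psi_repr.
exists (eps iota G G chi) => //.
rewrite inE; apply/hasP; exists K.
  by apply/(shoda_kernelsP G a b n_ge3); exists j, e.
apply/asboolP; exists chi => //.
by rewrite eC_of_central //; apply: orbit_idem_central eO.
Qed.

(** This trades the list of kernels for all linear characters of G. For the converse, an orbit
    idempotent is determined by its character, so e is the one built from the kernel. *)
Lemma central_partP e : e \in E1 <->
  (e \in group_ring F G)%MS /\ exists2 psi, is_char G psi & orbit_idem iota G psi e.
Proof.
split=> [|[_ [psi psiC eO]]]; last first.
  have [f fE fO] := central_part_of_char psiC.
  by rewrite (orbit_idem_eq card_pres_neq0 (subxx G) psiC psiC eO fO (same_refl _ _ _)).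
rewrite inE => /hasP[K /(shoda_kernelsP G a b n_ge3)[j [d [jn KE]]] /asboolP[chi chi_f ->]].
have nKG : K <| G by rewrite KE; exact: (shoda_kernel_normal n_ge3 presG gamma_faithful d jn).
have chiC : is_char G (fun x => chi (coset K x)).
  have cC : is_char (G / K)%G chi by case: chi_f.
  have nK x : x \in G -> x \in 'N(K) by apply: subsetP; apply: normal_norm.
  split; first by rewrite morph1 (lchar1 cC).
  by move=> x y Gx Gy; rewrite morphM ?nK // (lcharM cC) // mem_quotient.
have eO := eps_orbit_idem iota coprime_pres_q (subxx G) nKG chi_f.
rewrite eC_of_central; last exact: orbit_idem_central chiC eO.
by split; [apply: eps_mem | exists (fun x => chi (coset K x))].
Qed.

Lemma central_part_center e : e \in E1 -> (e \in 'Z(group_ring F G))%MS.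
Proof.
case/central_partP => eA [psi psiC eO]; rewrite sub_capmx eA /=.
by apply/cent_mxP; apply: group_ring_comm; apply: orbit_idem_central eO.
Qed.

End Central.

(** * Components of the faithful characters of <a> *)

Section FieldInverse.
Variables (F : finFieldType) (L : closedFieldType) (iota : {rmorphism F -> L}).
Variables (gT : finGroupType) (G : {group gT}).
Local Notation q := #|F|.
Local Notation aG := (regular_repr F G).

Lemma map_mx_expr_eigen (c : 'M[F]_#|G|) (M : 'M[L]_#|G|) z k :
  map_mx iota c *m M = z *: M -> map_mx iota (c ^+ k) *m M = z ^+ k *: M.
Proof.
move=> cM; elim: k => [|k IHk]; first by rewrite expr0 map_mx1 mul1mx scale1r.
by rewrite exprSr map_mxM -mulmxA cM -scalemxAr IHk scalerA -exprS.
Qed.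

(* F[C] acts on x through the Frobenius conjugates of psi, whose values lie in the
   field of q^o elements: either c x = 0, or c^(q^o - 2) inverts c on x. *)
Lemma field_inverse (H C : {group gT}) (psi phi : gT -> L) (f : gT -> F) o x :
    H \subset G -> C \subset H -> is_char H phi -> {in C, phi =1 psi} ->
    orbit_idem iota H phi x -> {in C, forall y, psi y ^+ (q ^ o) = psi y} ->
  let c : 'M[F]_#|G| := \sum_(y in C) f y *: aG y in
  let z := \sum_(y in C) iota (f y) * psi y in
  (z = 0 -> c *m x = 0) /\ (z != 0 -> c ^+ (q ^ o).-1 *m x = x).
Proof.
move=> sHG sCH phiC phi_psi [o' [o'_gt0 _ xE]] psi_o c z.
have zo : z ^+ (q ^ o) = z.
  rewrite (frob_sum iota); apply: eq_bigr => y Cy.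
  by rewrite exprMn frob_iota psi_o.
have cM t : map_mx iota c *m idc G H (fun y => phi y ^+ (q ^ t)) =
    z ^+ (q ^ t) *: idc G H (fun y => phi y ^+ (q ^ t)).
  rewrite map_mx_sum mulmx_suml (frob_sum iota) scaler_suml; apply: eq_bigr => y Cy.
  have Hy := subsetP sCH y Cy.
  rewrite map_mxZ map_regular_mx -scalemxAl (mul_idc sHG (lchar_exp phiC _)) //.
  by rewrite scalerA exprMn frob_iota phi_psi.
split=> [z0|z0]; apply: (map_mx_inj (f := iota)); rewrite map_mxM ?map_mx0 xE mulmx_sumr.
  by apply: big1 => t _; rewrite cM z0 expr0n gtn_eqF ?expq_gt0 // scale0r.
apply: eq_bigr => t _; rewrite (map_mx_expr_eigen _ (cM t)) exprAC.
suff -> : z ^+ (q ^ o).-1 = 1 by rewrite expr1n scale1r.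
by apply: (mulfI z0); rewrite -exprS prednK ?expq_gt0 // zo mulr1.
Qed.

Lemma group_ring_expr (c : 'M[F]_#|G|) k :
  (c \in group_ring F G)%MS -> (c ^+ k \in group_ring F G)%MS.
Proof.
move=> cA; elim: k => [|k IHk]; first by rewrite expr0 group_ring1.
by rewrite exprS group_ringM.
Qed.

(** q odd makes q^o at least 3, so the exponent q^o - 2 is not truncated. *)
Lemma expr_pred2_mul (c : 'M[F]_#|G|) o : odd q -> (0 < o)%N ->
  c ^+ (q ^ o).-2 *m c = c ^+ (q ^ o).-1.
Proof.
move=> q_odd o_gt0; have q_gt2 : (2 < q)%N.
  by rewrite ltn_neqAle card_field_gt1 andbT; apply: contraTneq q_odd => <-.
have qo_gt2 : (2 < q ^ o)%N.
  by rewrite (leq_trans q_gt2) // -{1}(expn1 q) leq_pexp2l // ltnW // ltnW.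
by rewrite -[_ *m c]/(_ * c) -exprSr prednK // -subn1 subn_gt0 ltnW.
Qed.

End FieldInverse.

Section Faithful.
Variables (F : finFieldType) (L : closedFieldType) (iota : {rmorphism F -> L}).
Variables (n : nat) (gT : finGroupType) (G : {group gT}) (a b : gT).
Hypotheses (n_ge3 : (3 <= n)%N) (presG : presented_by_ab G n a b).
Hypothesis (q_odd : odd #|F|).
Variables (gamma : gT -> L).
Hypothesis gamma_faithful : faithful_char <[a]> gamma.
Local Notation N := (2 ^ n)%N.
Local Notation s := (2 ^ n.-1)%N.
Local Notation q := #|F|.
Local Notation aG := (regular_repr F G).
Local Notation FG := (group_ring F G).
Local Notation epsA k := (eps iota G <[a]>%G (fun X : coset_of 1%G => gamma (repr X) ^ k)).
Local Notation eA k := (eC_cyclic iota G a gamma k).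

Let Ga := pres_a presG.
Let Gb := pres_b presG.
Let sAG : <[a]>%G \subset G := cycle_a_sub presG.
Let gC := gamma_char gamma_faithful.
Let prim := gamma_prim n_ge3 presG gamma_faithful.
Let G_L := card_pres_neq0 n_ge3 presG gamma_faithful.

Lemma gamma_expN x : x \in <[a]> -> gamma x ^+ N = 1.
Proof.
by move=> ax; rewrite -(lcharX gC) // -(order_a n_ge3 presG) expg_cardG ?(lchar1 gC).
Qed.

(** Negative exponents are multiplied by -(N-1), which is 1 modulo N; N-1 being odd, the parity is
    kept. *)
Lemma gamma_exprz (k : int) : exists2 l : nat, odd l = odd `|k| &
  {in <[a]>, forall x, gamma x ^ k = gamma x ^+ l}.
Proof.
case: k => m; first by exists m.
have N_gt0 : (0 < N)%N by rewrite expn_gt0.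
exists (N.-1 * m.+1)%N.
  rewrite oddM -subn1 oddB // oddX /=.
  by case: n n_ge3.
move=> x ax; have gx := lchar_neq0 gC ax.
have -> : gamma x ^ Negz m = (gamma x)^-1 ^+ m.+1 by rewrite exprVn.
rewrite exprM; congr (_ ^+ _); apply: (mulfI gx).
by rewrite mulfV // -exprS prednK // gamma_expN.
Qed.

Lemma gamma_exp_inj l : odd l -> {in <[a]> &, injective (fun x => gamma x ^+ l)}.
Proof.
move=> l_odd x y ax ay /= xy; case: gamma_faithful => _; apply=> //.
pose z := gamma (x * y^-1)%g.
have zl : z ^+ l = 1.
  rewrite /z (lcharM gC) ?groupV // exprMn xy -exprMn (lcharV gC) //.
  by rewrite expr1n.
have zN : z ^+ N = 1 by rewrite gamma_expN // groupM ?groupV.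
have [m pm ml] := prim_order_exists (odd_gt0 l_odd) zl.
have m1 : (m %| gcdn l N)%N by rewrite dvdn_gcd ml (prim_order_dvd pm) zN eqxx.
have {m1} : m = 1%N.
  have co : coprime l N by rewrite coprimeXr // coprimen2.
  by move: m1; rewrite (eqP co) dvdn1 => /eqP.
move=> m1; have := prim_expr_order pm; rewrite m1 expr1 => z1.
have := lcharV gC (x := y) ay; rewrite -[RHS]z1 /z (lcharM gC) ?groupV //.
have yn := lchar_neq0 gC (groupVr ay).
by move=> /(mulIf yn).
Qed.

Lemma gamma_exp_char l : is_char <[a]>%G (fun x => gamma x ^+ l).
Proof. exact: (lchar_exp gC l). Qed.

Lemma epsA_orbit_idem (k : int) l : odd l ->
    {in <[a]>, forall x, gamma x ^ k = gamma x ^+ l} ->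
  orbit_idem iota <[a]>%G (fun x => gamma x ^+ l) (epsA k).
Proof.
move=> l_odd kl.
have repr1 x : repr (coset 1%G x) = x.
  have : repr (coset 1%G x) \in coset 1%G x by apply: mem_repr_coset.
  by rewrite val_coset ?norm1 ?inE // => /rcosetP[y /set1P-> ->]; rewrite mul1g.
have chi_f : faithful_char (<[a]>%G / 1%G)%g (fun X : coset_of 1%G => gamma (repr X) ^ k).
  split; first split.
  - by rewrite -(coset_id (group1 1%G)) repr1 kl // (lchar1 gC) expr1n.
  - move=> _ _ /morphimP[x nx ax ->] /morphimP[y ny ay ->].
    rewrite -morphM // !repr1 !kl ?groupM // (lcharM gC) //.
    by rewrite exprMn.
  move=> _ _ /morphimP[x nx ax ->] /morphimP[y ny ay ->].
  by rewrite !repr1 !kl // => /(gamma_exp_inj l_odd ax ay) ->.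
have := eps_orbit_idem iota (coprime_pres_q n_ge3 presG q_odd) sAG (normal1 _) chi_f.
by apply: orbit_idem_ext => x ax; rewrite repr1 kl.
Qed.

Definition gring_conjugates (x : 'M[F]_#|G|) : {set 'M[F]_#|G|} :=
  [set aG g^-1%g *m x *m aG g | g in G].

Lemma eA_sum k : eA k = \sum_(x in gring_conjugates (epsA k)) x. Proof. by []. Qed.

(** <a> is abelian, so g acts on it trivially or as b does, according to its class modulo <a>. *)
Lemma conj_exp g l : g \in G -> exists2 l', (l' = l \/ l' = l * (1 + s))%N &
  {in <[a]>, forall x, gamma (x ^ g^-1)%g ^+ l = gamma x ^+ l'}.
Proof.
move=> Gg; have abel := cycle_abelian a.
have conj_id x y : x \in <[a]> -> y \in <[a]> -> (x ^ y = x)%g.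
  by move=> ax ay; apply/conjg_fixP/commgP; apply: (centsP abel).
have [ag|agb] := pres_cases presG Gg.
  by exists l; [left | move=> x ax; rewrite conj_id ?groupV].
exists (l * (1 + s))%N; first by right.
move=> x ax; rewrite -{1}(mulgK b g) invMg (inv_b presG) conjgM.
rewrite (inv_b presG) (conj_ab presG) // conj_id ?groupX ?groupV //.
by rewrite (lcharX gC) // -exprM mulnC.
Qed.

Lemma s_even : ~~ odd s.
Proof. by rewrite oddX; case: n n_ge3 => [|[|m]]. Qed.

(** Covers the conjugates of eps for all odd k at once, so that idempotents belonging to different k
    can be compared. *)
Definition faithful_idem (x : 'M[F]_#|G|) : Prop :=
  (x \in FG)%MS /\ exists2 l, odd l & orbit_idem iota <[a]>%G (fun y => gamma y ^+ l) x.

Lemma gring_conjugates_char (k : int) l x : odd l ->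
    {in <[a]>, forall x, gamma x ^ k = gamma x ^+ l} ->
    x \in gring_conjugates (epsA k) ->
  (x \in FG)%MS /\ exists2 l', (l' = l \/ l' = l * (1 + s))%N &
    orbit_idem iota <[a]>%G (fun y => gamma y ^+ l') x.
Proof.
move=> l_odd kl /imsetP[g Gg ->]; split.
  by rewrite !group_ringM ?group_ringG ?groupV // eps_mem ?normal1.
have [l' l'E gE] := conj_exp l Gg; exists l' => //.
have nag : g \in 'N(<[a]>%G) := subsetP (normal_norm (cycle_a_normal presG)) g Gg.
have := orbit_idem_conj sAG Gg nag (epsA_orbit_idem l_odd kl).
exact: orbit_idem_ext.
Qed.

Lemma gring_conjugates_faithful k x : odd `|k| ->
  x \in gring_conjugates (epsA k) -> faithful_idem x.
Proof.
move=> k_odd xk; have [l lk kl] := gamma_exprz k; rewrite -lk in k_odd.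
have [xA [l' l'E xO]] := gring_conjugates_char k_odd kl xk; split=> //; exists l' => //.
by case: l'E => ->; rewrite // oddM oddD k_odd (negPf s_even).
Qed.

Lemma faithful_idemM x y : faithful_idem x -> faithful_idem y ->
  x *m y = if x == y then x else 0.
Proof.
move=> [_ [l _ xO]] [_ [m _ yO]]; have lC := gamma_exp_char l; have mC := gamma_exp_char m.
case: eqP => [<-|xy]; first exact: (orbit_idem_idem G_L sAG lC xO).
apply: (orbit_idem_orth sAG lC mC xO yO) => sm; apply: xy.
exact: (orbit_idem_eq G_L sAG lC mC xO yO).
Qed.

(** On each summand a^s acts as (-1)^(l q^t), and both l and q are odd. *)
Lemma faithful_idem_half x : faithful_idem x -> aG (a ^+ s)%g *m x = - x.
Proof.
case=> _ [l l_odd [o [_ _ xE]]]; apply: (map_mx_inj (f := iota)).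
rewrite map_mxM map_mxN map_regular_mx xE mulmx_sumr -sumrN; apply: eq_bigr => t _.
rewrite (mul_idc sAG (lchar_exp (gamma_exp_char l) _)) ?mem_cycle //.
rewrite (lcharX gC) ?cycle_id // -!exprM mulnC.
rewrite (exp_half n_ge3 presG gamma_faithful) -signr_odd oddM l_odd oddX q_odd orbT.
by rewrite expr1 scaleN1r.
Qed.

Section OneOrbit.
Variables (k : int) (k_odd : odd `|k|).
Let S := gring_conjugates (epsA k).
Let SF x : x \in S -> faithful_idem x. Proof. exact: gring_conjugates_faithful. Qed.

Lemma eA_mem : (eA k \in FG)%MS.
Proof. by rewrite eA_sum; apply: group_ring_sum => x /SF[]. Qed.

Lemma eA_mul x : x \in S -> eA k *m x = x.
Proof.
move=> Sx; rewrite eA_sum mulmx_suml (bigD1 x) //= (faithful_idemM (SF Sx) (SF Sx)) eqxx.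
rewrite big1 ?addr0 // => y /andP[Sy yx].
by rewrite (faithful_idemM (SF Sy) (SF Sx)) (negPf yx).
Qed.

Lemma eA_idem : eA k *m eA k = eA k.
Proof. by rewrite {2}eA_sum mulmx_sumr; apply: eq_bigr => x /eA_mul. Qed.

(** Conjugation by g permutes the set of conjugates over which e_k is summed. *)
Lemma eA_comm g : g \in G -> aG g *m eA k = eA k *m aG g.
Proof.
move=> Gg; suff E : aG g^-1%g *m eA k *m aG g = eA k.
  by rewrite -{1}E !mulmxA -repr_mxM ?groupV // mulgV repr_mx1 mul1mx.
rewrite eA_sum mulmx_sumr mulmx_suml.
pose f (x : 'M[F]_#|G|) := aG g^-1%g *m x *m aG g.
pose f' (x : 'M[F]_#|G|) := aG g *m x *m aG g^-1%g.
have ff' : cancel f f'.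
  move=> x; rewrite /f /f' !mulmxA -repr_mxM ?groupV // mulgV repr_mx1 mul1mx.
  by rewrite -mulmxA -repr_mxM ?groupV // mulgV repr_mx1 mulmx1.
have fS x : x \in S -> f x \in S.
  move=> /imsetP[h Gh ->]; apply/imsetP; exists (h * g)%g; rewrite ?groupM //.
  by rewrite /f invMg !repr_mxM ?groupV // !mulmxA.
have f'S x : x \in S -> f' x \in S.
  move=> /imsetP[h Gh ->]; apply/imsetP; exists (h * g^-1)%g; rewrite ?groupM ?groupV //.
  by rewrite /f' invMg invgK !repr_mxM ?groupV // !mulmxA.
rewrite [RHS](reindex_inj (can_inj ff')); apply: eq_bigl => x.
by apply/idP/idP => [/fS //|/f'S]; rewrite ff'.
Qed.

Lemma eA_half : aG (a ^+ s)%g *m eA k = - eA k.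
Proof.
by rewrite eA_sum mulmx_sumr -sumrN; apply: eq_bigr => x /SF/faithful_idem_half.
Qed.

Lemma eA_center x : (x \in FG)%MS -> x *m eA k = eA k *m x.
Proof. exact/group_ring_comm/eA_comm. Qed.

(** The scalar z through which c acts is the same for all conjugates of eps, so one power of c
    inverts it on every summand of e_k simultaneously. *)
Lemma eA_field (f : gT -> F) : let c : 'M[F]_#|G| := \sum_(y in <[(a ^+ 2)%g]>) f y *: aG y in
  c *m eA k != 0 -> exists2 d, (d \in FG)%MS & d *m c *m eA k = eA k.
Proof.
move=> c ce0; have [l lk kl] := gamma_exprz k; have l_odd := k_odd; rewrite -lk in l_odd.
pose o := order_mod N q.
have s2A : <[(a ^+ 2)%g]>%G \subset <[a]>%G by rewrite cycle_subG mem_cycle.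
pose psi x := gamma x ^+ l.
have psi_o : {in <[(a ^+ 2)%g]>%G, forall y, psi y ^+ (q ^ o) = psi y}.
  move=> y /(subsetP s2A)/cycleP[i ->]; rewrite /psi (lcharX gC) ?cycle_id //.
  rewrite exprAC [_ ^+ i ^+ (_ ^ _)]exprAC; congr (_ ^+ _ ^+ _); rewrite -[RHS]expr1.
  apply/eqP; rewrite (eq_prim_root_expr prim) order_modP ?dvdnn ?expn_gt0 //.
  exact: coprime_2X_q.
pose z := \sum_(y in <[(a ^+ 2)%g]>%G) iota (f y) * psi y.
have SI x : x \in S -> (z = 0 -> c *m x = 0) /\ (z != 0 -> c ^+ (q ^ o).-1 *m x = x).
  move=> Sx; have [_ [l' l'E xO]] := gring_conjugates_char l_odd kl Sx.
  apply: (field_inverse f sAG s2A (gamma_exp_char l') _ xO psi_o).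
  move=> y /cycleP[i ->]; rewrite /psi -expgM (lcharX gC) ?cycle_id //.
  (* gamma^l and gamma^(l(1+s)) differ on (a^2)^i by an even power of w^s = -1, hence agree on
     <a^2>. *)
  case: l'E => -> //; rewrite mulnDr muln1 exprD -[RHS]mulr1; congr (_ * _).
  rewrite -exprM mulnA (exp_half n_ge3 presG gamma_faithful) -signr_odd.
  by rewrite !oddM.
have [z0|z0] := eqVneq z 0.
  case/eqP: ce0; rewrite eA_sum mulmx_sumr big1 // => x Sx.
  by case: (SI x Sx) => ->.
exists (c ^+ (q ^ o).-2).
  apply/group_ring_expr/group_ring_sum => y /(subsetP s2A) ay.
  by apply/group_ringZ/group_ringG/(subsetP sAG).
rewrite expr_pred2_mul ?order_mod_gt0 //.
by rewrite eA_sum mulmx_sumr; apply: eq_bigr => x Sx; case: (SI x Sx) => _ ->.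
Qed.

End OneOrbit.
End Faithful.

(** * The left ideals of a faithful component *)

Section Structure.
Variables (F : finFieldType) (L : closedFieldType) (iota : {rmorphism F -> L}).
Variables (n : nat) (gT : finGroupType) (G : {group gT}) (a b : gT).
Hypotheses (n_ge3 : (3 <= n)%N) (presG : presented_by_ab G n a b).
Hypothesis (q_odd : odd #|F|).
Variables (gamma : gT -> L).
Hypothesis gamma_faithful : faithful_char <[a]> gamma.
Local Notation N := (2 ^ n)%N.
Local Notation s := (2 ^ n.-1)%N.
Local Notation q := #|F|.
Local Notation aG := (regular_repr F G).
Local Notation R := (regular_repr L G).
Local Notation FG := (group_ring F G).
Local Notation lin := (lin a b gamma).
Local Notation epsA k := (eps iota G <[a]>%G (fun X : coset_of 1%G => gamma (repr X) ^ k)).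
Local Notation eA k := (eC_cyclic iota G a gamma k).

Let Ga := pres_a presG.
Let Gb := pres_b presG.
Let sAG : <[a]>%G \subset G := cycle_a_sub presG.
Let G_L := card_pres_neq0 n_ge3 presG gamma_faithful.

Lemma two_neq0F : 2%:R != 0 :> F.
Proof.
rewrite -(fmorph_eq0 iota) rmorph_nat.
exact: (two_neq0 n_ge3 presG gamma_faithful).
Qed.

Lemma neg_eq0 m (x : 'M[F]_m) : x = - x -> x = 0.
Proof.
move/eqP; rewrite -subr_eq0 opprK -mulr2n -scaler_nat scaler_eq0.
by rewrite (negPf two_neq0F) => /eqP.
Qed.

(* The idempotents hat <b> (sg = false) and 1 - hat <b> (sg = true). *)
Definition hatb (sg : bool) : 'M[F]_#|G| := 2%:R^-1 *: (1%:M + (-1) ^+ sg *: aG b).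

Let bb : aG b *m aG b = 1%:M.
Proof. by rewrite -repr_mxM // (sqr_b presG) repr_mx1. Qed.

Let half2 : 2%:R^-1 * 2%:R = 1 :> F. Proof. by rewrite mulVf ?two_neq0F. Qed.

Lemma hat_cycle_b : hat F G <[b]> = hatb false.
Proof.
have b1 : b != 1%g.
  by apply: contraNneq (b_notin n_ge3 presG) => ->; rewrite group1.
have bE : <[b]> = [set 1%g; b].
  apply/setP => x; rewrite !inE; apply/idP/orP => [/(mem_cycle_b presG)[]->|[]/eqP->].
  - by left.
  - by right.
  - exact: group1.
  exact: cycle_id.
rewrite /hat /hatb /gset_mx bE cards2 eq_sym b1 big_setU1 ?inE ?big_set1 1?eq_sym //=.
by rewrite [regular_mx _ _ 1%g](repr_mx1 aG) expr0 scale1r.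
Qed.

Lemma hatb_true : hatb true = 1%:M - hatb false.
Proof.
rewrite /hatb expr1 expr0 scaleN1r scale1r.
have one2 : 1%:M = 2%:R^-1 *: (1%:M + 1%:M) :> 'M[F]_#|G|.
  by rewrite -mulr2n -scaler_nat scalerA half2 scale1r.
rewrite [X in _ = X - _]one2 -scalerBr; congr (_ *: _).
by rewrite opprD addrACA subrr add0r.
Qed.

Lemma hatb_mem sg : (hatb sg \in FG)%MS.
Proof.
by apply/group_ringZ/group_ringD; [apply: group_ring1 | apply/group_ringZ/group_ringG].
Qed.

Lemma b_hatb sg : aG b *m hatb sg = (-1) ^+ sg *: hatb sg.
Proof.
rewrite -scalemxAr mulmxDr mulmx1 -scalemxAr bb scalerA mulrC -scalerA.
congr (_ *: _); rewrite scalerDr scalerA -signr_addb addbb expr0 scale1r.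
by rewrite addrC.
Qed.

Lemma hatb_mul sg tau : hatb sg *m hatb tau = if sg == tau then hatb sg else 0.
Proof.
rewrite -scalemxAl mulmxDl mul1mx -scalemxAl b_hatb scalerA -[X in X + _]scale1r.
rewrite -scalerDl scalerA.
case: sg tau => [] []; rewrite ?expr0 ?expr1 ?mulrNN ?mul1r ?mulr1 ?subrr ?addrN;
  by rewrite ?mulr0 ?scale0r // -(natrD _ 1 1) half2 scale1r.
Qed.

Section Faithful.
Variables (k : int) (k_odd : odd `|k|).
Let e := eA k.

Let eA_comm' g : g \in G -> aG g *m e = e *m aG g.
Proof. exact: eA_comm. Qed.

Let e_half : aG (a ^+ s)%g *m e = - e.
Proof. exact: (eA_half iota n_ge3 presG q_odd gamma_faithful k_odd). Qed.

Lemma epsA_gring_conjugates : epsA k \in gring_conjugates (epsA k).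
Proof. by apply/imsetP; exists 1%g; rewrite // invg1 repr_mx1 mul1mx mulmx1. Qed.

Lemma eA_neq0 : e != 0.
Proof.
have xS := epsA_gring_conjugates.
have ex := eA_mul n_ge3 presG q_odd gamma_faithful k_odd xS.
have [_ [l _ xO]] := gring_conjugates_faithful n_ge3 presG q_odd gamma_faithful k_odd xS.
have : epsA k != 0 := orbit_idem_neq0 G_L sAG (gamma_exp_char gamma_faithful l) xO.
by apply: contraNneq => e0; rewrite -ex -/e e0 mul0mx.
Qed.

Let e_b_hatb sg : aG b *m (e *m hatb sg) = (-1) ^+ sg *: (e *m hatb sg).
Proof. by rewrite mulmxA eA_comm' // -mulmxA b_hatb -scalemxAr. Qed.

(* If e vanished on hatb sg, then b would act on e as a scalar, and so would
   a b a^-1 = b a^s; but a^s acts as -1. *)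
Lemma eA_hatb_neq0 sg : e *m hatb sg != 0.
Proof.
apply/negP => /eqP e0.
have eb : e *m aG b = - (-1) ^+ sg *: e.
  move/(congr1 ( *:%R 2%:R)): e0; rewrite scaler0 -scalemxAr scalerA mulfV ?two_neq0F //.
  rewrite scale1r mulmxDr mulmx1 -scalemxAr => /eqP; rewrite addrC addr_eq0 => /eqP.
  move/(congr1 ( *:%R ((-1) ^+ sg))); rewrite scalerA -signr_addb addbb scale1r => ->.
  by rewrite scalerN scaleNr.
have abE : (a * b * a^-1 = b * a ^+ s)%g.
  have := conj_ab presG (cycle_id a); rewrite conjgE => /(canRL (mulKVg b)) ->.
  by rewrite expgD expg1 -expgS expgSr mulgA mulgK.
have e1 : e *m aG (a * b * a^-1)%g = - (-1) ^+ sg *: e.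
  rewrite !repr_mxM ?groupM ?groupV // !mulmxA -eA_comm' // -[_ *m e *m _]mulmxA eb.
  rewrite -scalemxAr -scalemxAl eA_comm' // -mulmxA -repr_mxM ?groupV // mulgV.
  by rewrite repr_mx1 mulmx1.
have := e1; rewrite abE repr_mxM ?groupX // mulmxA eb -scalemxAl -eA_comm' ?groupX //.
rewrite e_half scalerN => /esym/neg_eq0/eqP; rewrite scaler_eq0 oppr_eq0 signr_eq0.
by rewrite (negPf eA_neq0).
Qed.

Let in_sq (c : 'M[F]_#|G|) :=
  exists f : gT -> F, c = \sum_(y in <[(a ^+ 2)%g]>) f y *: aG y.

(** b passes through the central e and acts on [hatb sg] as the sign, so v may be taken in F[a]; its
    odd powers of a contribute to c1, the even ones to c0. *)
Lemma eA_hatb_form sg v : (v \in FG)%MS -> exists c0 c1, [/\ in_sq c0, in_sq c1 &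
  v *m (e *m hatb sg) = (c0 + c1 *m aG a) *m (e *m hatb sg)].
Proof.
have in_sq0 : in_sq 0.
  by exists (fun=> 0); rewrite big1 // => y _; rewrite scale0r.
have in_sqG y c : y \in <[(a ^+ 2)%g]> -> in_sq (c *: aG y).
  move=> ay; exists (fun x => if x == y then c else 0).
  rewrite (bigD1 y) //= eqxx big1 ?addr0 // => x /andP[_ /negPf->].
  by rewrite scale0r.
have in_sqD c d : in_sq c -> in_sq d -> in_sq (c + d).
  move=> [f ->] [g ->]; exists (fun x => f x + g x).
  by rewrite -big_split; apply: eq_bigr => y _; rewrite scalerDl.
case/envelop_mxP => f ->.
apply: (big_ind (fun v => exists c0 c1, [/\ in_sq c0, in_sq c1 &
  v *m (e *m hatb sg) = (c0 + c1 *m aG a) *m (e *m hatb sg)])).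
- by exists 0, 0; rewrite !mul0mx addr0 mul0mx.
- move=> u u' [c0 [c1 [h0 h1 uE]]] [d0 [d1 [k0 k1 vE]]].
  exists (c0 + d0), (c1 + d1); split; [exact: in_sqD | exact: in_sqD |].
  by rewrite mulmxDl uE vE -mulmxDl addrACA -mulmxDl.
have form_a c i : exists c0 c1, [/\ in_sq c0, in_sq c1 &
    c *: aG (a ^+ i)%g = c0 + c1 *m aG a].
  have ai : (a ^+ i = (a ^+ 2) ^+ i./2 * a ^+ odd i)%g.
    by rewrite -expgM -expgD mul2n addnC odd_double_half.
  case: (odd i) ai => ai.
    exists 0, (c *: aG ((a ^+ 2) ^+ i./2)%g); split; rewrite ?in_sqG ?mem_cycle //.
      by apply: in_sqG; rewrite mem_cycle.
    by rewrite add0r ai repr_mxM ?groupX // -scalemxAl expg1.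
  exists (c *: aG ((a ^+ 2) ^+ i./2)%g), 0; split=> //.
    by apply: in_sqG; rewrite mem_cycle.
  by rewrite mul0mx addr0 ai mulg1.
move=> g Gg; have [[i ->]|[i ->]] := pres_forms presG Gg.
  by have [c0 [c1 [h0 h1 ->]]] := form_a (f (a ^+ i)%g) i; exists c0, c1.
have [c0 [c1 [h0 h1 cE]]] := form_a ((-1) ^+ sg * f (a ^+ i * b)%g) i.
exists c0, c1; split=> //; rewrite -cE repr_mxM ?groupX // -!scalemxAl -mulmxA e_b_hatb.
by rewrite -scalemxAr scalerA mulrC.
Qed.

Let in_sq_b c : in_sq c -> aG b *m c = c *m aG b.
Proof.
case=> f ->; rewrite mulmx_sumr mulmx_suml; apply: eq_bigr => y /cycleP[i ->].
rewrite -scalemxAr -scalemxAl -!repr_mxM ?groupX //; congr (_ *: aG _).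
by rewrite -expgM (commute_even n_ge3 presG) // oddM.
Qed.

Let aGV g : g \in G -> aG g^-1%g *m aG g = 1%:M.
Proof. by move=> Gg; rewrite -repr_mxM ?groupV // mulVg repr_mx1. Qed.

(* Multiplying by (1 +- b)/2 isolates the even and the odd part in a of an element
   c0 + c1 a, and one of c0, c1 is nonzero in the field F[a^2] e. *)
Lemma eA_hatb_inv sg v : (v \in FG)%MS -> v *m (e *m hatb sg) != 0 ->
  exists2 u, (u \in FG)%MS & u *m v *m (e *m hatb sg) = e *m hatb sg.
Proof.
move=> vA; have [c0 [c1 [h0 h1 vE]]] := eA_hatb_form sg vA.
set x := e *m hatb sg in vE *; set sgn : F := (-1) ^+ sg.
have sgn2 : sgn * sgn = 1 by rewrite -signr_addb addbb.
have bx : aG b *m x = sgn *: x := e_b_hatb sg.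
have asx : aG (a ^+ s)%g *m x = - x by rewrite mulmxA e_half mulNmx.
have ba : aG b *m aG a = aG a *m aG (a ^+ s)%g *m aG b.
  rewrite -!repr_mxM ?groupM ?groupX //; congr (aG _).
  rewrite -expgS -add1n -(conj_ab presG (cycle_id a)) conjgE (inv_b presG).
  by rewrite -!mulgA (sqr_b presG) mulg1.
(* b commutes with F[a^2] and passes a at the cost of a^s, which acts as -1. So b acts as [sgn] on
   c0 x and as -[sgn] on c1 a x. *)
have bv : aG b *m (v *m x) = sgn *: (c0 *m x - c1 *m aG a *m x).
  have b0 : aG b *m (c0 *m x) = sgn *: (c0 *m x).
    by rewrite mulmxA (in_sq_b h0) -mulmxA bx -scalemxAr.
  have b1 : aG b *m (c1 *m (aG a *m x)) = - (sgn *: (c1 *m (aG a *m x))).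
    rewrite mulmxA (in_sq_b h1) -mulmxA (mulmxA (aG b)) ba -!mulmxA bx -!scalemxAr asx.
    by rewrite !mulmxN scalerN.
  by rewrite vE mulmxDl mulmxDr -(mulmxA c1) b0 b1 scalerBr.
have P t : (2%:R^-1 *: (1%:M + t *: aG b) \in FG)%MS.
  by apply/group_ringZ/group_ringD; [apply: group_ring1 | apply/group_ringZ/group_ringG].
have even : 2%:R^-1 *: (1%:M + sgn *: aG b) *m (v *m x) = c0 *m x.
  rewrite -scalemxAl mulmxDl mul1mx -scalemxAl bv scalerA sgn2 scale1r vE mulmxDl.
  by rewrite addrACA subrr addr0 -mulr2n -scaler_nat scalerA half2 scale1r.
have odd : 2%:R^-1 *: (1%:M + (- sgn) *: aG b) *m (v *m x) = c1 *m aG a *m x.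
  rewrite -scalemxAl mulmxDl mul1mx -scalemxAl bv scalerA mulNr sgn2 scaleN1r vE mulmxDl.
  rewrite opprB addrC addrA subrK -mulr2n -scaler_nat scalerA half2.
  by rewrite scale1r.
move=> vx0; have [c0x|c0x] := eqVneq (c0 *m e) 0.
  have c1e : c1 *m e != 0.
    apply: contraNneq vx0 => c1e.
    rewrite vE mulmxDl -(mulmxA c1) /x !mulmxA c0x mul0mx add0r.
    by rewrite -(mulmxA c1) eA_comm' // mulmxA c1e !mul0mx.
  case: h1 => f c1E; rewrite c1E in c1e.
  have [d dA dE] := eA_field n_ge3 presG q_odd gamma_faithful k_odd c1e.
  rewrite -c1E -/e in dE.
  (* The projector isolates c1 a x, then d cancels c1 and a^-1 cancels a. *)
  exists (aG a^-1%g *m d *m (2%:R^-1 *: (1%:M + (- sgn) *: aG b))).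
    by rewrite !group_ringM ?group_ringG ?groupV.
  rewrite -!mulmxA odd /x -(mulmxA c1) (mulmxA (aG a)) eA_comm' //.
  by rewrite -(mulmxA e) (mulmxA c1) (mulmxA d) (mulmxA d) dE mulmxA eA_comm' ?groupV //
    -mulmxA (mulmxA (aG a^-1%g)) aGV // mul1mx.
case: h0 => f c0E; rewrite c0E in c0x.
have [d dA dE] := eA_field n_ge3 presG q_odd gamma_faithful k_odd c0x.
rewrite -c0E -/e in dE.
exists (d *m (2%:R^-1 *: (1%:M + sgn *: aG b))); first by rewrite group_ringM.
by rewrite -!mulmxA even /x !mulmxA dE.
Qed.

End Faithful.
End Structure.

(** * Orthogonality and completeness *)

Section Complete.
Variables (F : finFieldType) (L : closedFieldType) (iota : {rmorphism F -> L}).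
Variables (n : nat) (gT : finGroupType) (G : {group gT}) (a b : gT).
Hypotheses (n_ge3 : (3 <= n)%N) (presG : presented_by_ab G n a b).
Hypothesis (q_odd : odd #|F|).
Variables (gamma : gT -> L).
Hypothesis gamma_faithful : faithful_char <[a]> gamma.
Local Notation N := (2 ^ n)%N.
Local Notation s := (2 ^ n.-1)%N.
Local Notation q := #|F|.
Local Notation w := (gamma a).
Local Notation aG := (regular_repr F G).
Local Notation R := (regular_repr L G).
Local Notation FG := (group_ring F G).
Local Notation lin := (lin a b gamma).
Local Notation epsA k := (eps iota G <[a]>%G (fun X : coset_of 1%G => gamma (repr X) ^ k)).
Local Notation eA k := (eC_cyclic iota G a gamma k).
Local Notation E1 := (central_part iota G n a b).
Local Notation same := (@cyc_coset gT L q <[a]>%g).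

Let Ga := pres_a presG.
Let Gb := pres_b presG.
Let sAG : <[a]>%G \subset G := cycle_a_sub presG.
Let gC := gamma_char gamma_faithful.
Let prim := gamma_prim n_ge3 presG gamma_faithful.
Let G_L := card_pres_neq0 n_ge3 presG gamma_faithful.

Lemma memJ_cycle_a g x : g \in G -> ((x ^ g)%g \in <[a]>) = (x \in <[a]>).
Proof.
move=> Gg; apply: memJ_norm.
exact: (subsetP (normal_norm (cycle_a_normal presG)) g Gg).
Qed.

Lemma gamma_expz_period (k : int) x : x \in <[a]> ->
  (gamma x ^ k) ^+ (q ^ order_mod N q) = gamma x ^ k.
Proof.
move=> ax; have [l _ ->] := gamma_exprz n_ge3 presG gamma_faithful k => //.
have /cycleP[i ->] := ax; rewrite (lcharX gC) ?cycle_id //.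
rewrite exprAC [_ ^+ i ^+ (_ ^ _)]exprAC; congr (_ ^+ _ ^+ _); rewrite -[RHS]expr1.
apply/eqP; rewrite (eq_prim_root_expr prim) order_modP ?dvdnn ?expn_gt0 //.
exact: coprime_2X_q.
Qed.

(** Equality of two cosets reduces to one of them containing a single element of the other, since
    the Frobenius action is periodic. *)
Lemma same_orbitP (k l : int) : same_orbit q G a gamma k l <->
  exists2 g, g \in G & same (fun x => gamma (x ^ g^-1)%g ^ k) (fun x => gamma x ^ l).
Proof.
split=> [[g Gg E]|[g Gg [t lE]]].
  exists g => //; have : cyc_coset q <[a]> (fun x => gamma x ^ l) (fun x => gamma x ^ l).
    exact: same_refl.
  rewrite E => -[theta [t thetaE] lE]; exists t => x ax.
  have /(congr1 (fun f => f x)) /= -> := lE.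
  by rewrite thetaE // memJ_cycle_a ?groupV.
exists g => //; apply/funext => psi; apply/propext; split.
  (* Conjugate cosets are matched as functions on the whole type, while psi is arbitrary outside
     <a>; conjugating psi back everywhere gives a witness exact on both sides. *)
  move=> [u psiE]; exists (fun x => psi (x ^ g)%g).
    exists (t + u)%N => x ax; rewrite psiE ?memJ_cycle_a // lE ?memJ_cycle_a // conjgK.
    by rewrite frobM.
  by apply/funext => x; rewrite conjgKV.
move=> [theta [u thetaE] ->]; exists (u + (order_mod N q * t - t))%N => x ax.
rewrite thetaE ?memJ_cycle_a ?groupV // lE // frobM addnCA subnKC ?leq_pmull ?order_gt0 //.
rewrite addnC -frobM mulnC frob_mul_period //.
by rewrite gamma_expz_period // memJ_cycle_a ?groupV.
Qed.

Lemma epsA_char k : odd `|k| -> exists l, [/\ odd l,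
  {in <[a]>, forall x, gamma x ^ k = gamma x ^+ l} &
  orbit_idem iota <[a]>%G (fun x => gamma x ^+ l) (epsA k)].
Proof.
move=> k_odd; have [l lk kl] := gamma_exprz n_ge3 presG gamma_faithful k.
exists l; split; rewrite ?lk //.
by apply: (epsA_orbit_idem _ n_ge3 presG q_odd gamma_faithful _ kl); rewrite lk.
Qed.

Lemma gring_conjugates_orbit k g : odd `|k| -> g \in G ->
  is_char <[a]>%G (fun x => gamma (x ^ g^-1)%g ^ k) /\
  orbit_idem iota <[a]>%G (fun x => gamma (x ^ g^-1)%g ^ k) (aG g^-1%g *m epsA k *m aG g).
Proof.
move=> k_odd Gg; have [l [l_odd kl xO]] := epsA_char k_odd.
have klg x : x \in <[a]> -> gamma (x ^ g^-1)%g ^ k = gamma (x ^ g^-1)%g ^+ l.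
  by move=> ax; rewrite kl // memJ_cycle_a ?groupV.
split.
  split=> [|x y ax ay]; first by rewrite klg // conj1g (lchar1 gC) expr1n.
  rewrite !klg ?groupM // conjMg (lcharM gC) ?memJ_cycle_a ?groupV //.
  by rewrite exprMn.
have nag : g \in 'N(<[a]>%G) := subsetP (normal_norm (cycle_a_normal presG)) g Gg.
have := orbit_idem_conj sAG Gg nag xO.
by apply: orbit_idem_ext => x ax; rewrite klg.
Qed.

(** Conjugates of eps are equal or orthogonal. A conjugate common to k and l, by g and by h, puts
    both characters in one coset after conjugation by g h^-1. *)
Lemma eA_orth k l : odd `|k| -> odd `|l| -> ~ same_orbit q G a gamma k l ->
  eA k *m eA l = 0.
Proof.
move=> k_odd l_odd not_same.
have kF := gring_conjugates_faithful n_ge3 presG q_odd gamma_faithful k_odd.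
have lF := gring_conjugates_faithful n_ge3 presG q_odd gamma_faithful l_odd.
rewrite !eA_sum mulmx_suml big1 // => x xk; rewrite mulmx_sumr big1 // => y yl.
rewrite (faithful_idemM n_ge3 presG gamma_faithful (kF _ _ xk) (lF _ _ yl)).
case: eqP => // xy; case: not_same; apply/same_orbitP.
case/imsetP: xk => g Gg xE; case/imsetP: yl => h Gh yE.
have [xC xO] := gring_conjugates_orbit k_odd Gg; have [yC yO] := gring_conjugates_orbit l_odd Gh.
rewrite -xE in xO; rewrite -yE -xy in yO.
have [t tE] := orbit_idem_same G_L sAG xC yC xO yO.
exists (g * h^-1)%g; first by rewrite groupM ?groupV.
exists t => x' ax; have := tE (x' ^ h)%g; rewrite conjgK => -> //; last first.
  by rewrite memJ_cycle_a.
by rewrite -conjgM invMg invgK.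
Qed.

Lemma eA_absorb k l m : odd `|k| -> same_orbit q G a gamma k l ->
    {in <[a]>, forall x, gamma x ^ l = gamma x ^+ m} ->
  map_mx iota (eA k) *m idc G <[a]>%G (fun x => gamma x ^+ m) =
  idc G <[a]>%G (fun x => gamma x ^+ m).
Proof.
move=> k_odd /same_orbitP[g Gg sm] lm.
have [xC xO] := gring_conjugates_orbit k_odd Gg.
set x := _ *m epsA k *m _ in xO.
have xS : x \in gring_conjugates (epsA k) by apply/imsetP; exists g.
have ex := eA_mul n_ge3 presG q_odd gamma_faithful k_odd xS.
have mC := gamma_exp_char gamma_faithful m.
have sm' : same (fun x => gamma (x ^ g^-1)%g ^ k) (fun x => gamma x ^+ m).
  by case: sm => t tE; exists t => y ay; rewrite -lm // tE.
have xM := (orbit_idem_mul G_L sAG xO xC mC sm').1.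
by rewrite -{1}xM mulmxA -map_mxM ex xM.
Qed.

(** The coefficient at x different from 1 is a geometric sum in gamma(x^-1), an N-th root of unity
    other than 1. *)
Lemma sum_idc : \sum_(l < N) idc G <[a]>%G (fun x => gamma x ^+ l) = 1%:M.
Proof.
have N_neq0 : N%:R != 0 :> L by exact: (prim_root_natf_neq0 prim).
rewrite -scaler_sumr exchange_big /= (bigD1 1%g) //= [X in _ + X]big1 ?addr0.
  rewrite invg1 (lchar1 gC) -scaler_suml [regular_mx _ _ 1%g](repr_mx1 R).
  under eq_bigr do rewrite expr1n.
  rewrite sumr_const card_ord scalerA -[#|<[a]>|]orderE (order_a n_ge3 presG).
  by rewrite mulVf // scale1r.
move=> x /andP[ax x1]; rewrite -scaler_suml.
have zN : gamma x^-1%g ^+ N = 1 by rewrite (gamma_expN n_ge3 presG gamma_faithful) ?groupV.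
have z1 : gamma x^-1%g - 1 != 0.
  rewrite subr_eq0; apply: contraNneq x1 => z1; rewrite -invg_eq1; apply/eqP.
  by case: gamma_faithful => _; apply; rewrite ?groupV // z1 (lchar1 gC).
suff -> : \sum_(i < N) gamma x^-1%g ^+ i = 0 by rewrite scale0r.
by apply: (mulfI z1); rewrite -subrX1 zN subrr mulr0.
Qed.

(** Every linear character sends a to an even power of w, hence a^s to 1. *)
Lemma central_half e : e \in E1 -> aG (a ^+ s)%g *m e = e.
Proof.
case/(central_partP iota n_ge3 presG q_odd gamma_faithful) => _ [psi psiC [o [_ _ eE]]].
have ps : psi (a ^+ s)%g = 1.
  have [l [d [l_even _ psiE]]] := lin_surj n_ge3 presG gamma_faithful psiC.
  rewrite psiE ?groupX // (lin_expa b gamma_faithful).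
  rewrite -exprM (exp_half n_ge3 presG gamma_faithful).
  by rewrite -signr_odd (negPf l_even).
apply: (map_mx_inj (f := iota)); rewrite map_mxM map_regular_mx eE mulmx_sumr.
apply: eq_bigr => t _; rewrite (mul_idc (subxx G) (lchar_exp psiC _)) ?groupX //.
by rewrite ps expr1n scale1r.
Qed.

(** All of G acts on e through the values of psi, so the argument used for F[a^2] applies with G in
    place of <a^2>. *)
Lemma central_inv e v : e \in E1 -> (v \in FG)%MS -> v *m e != 0 ->
  exists2 u, (u \in FG)%MS & u *m v *m e = e.
Proof.
case/(central_partP iota n_ge3 presG q_odd gamma_faithful) => _ [psi psiC eO].
move=> vA ve0; have [o [o_gt0 oP _]] := eO.
have psi_o : {in G, forall y, psi y ^+ (q ^ o) = psi y} by apply/oP.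
have /envelop_mxP[f vE] := vA.
have [z0 z1] := field_inverse f (subxx G) (subxx G) psiC (in1W (fun=> erefl)) eO psi_o.
rewrite -vE in z0 z1.
exists (v ^+ (q ^ o).-2); first exact: group_ring_expr.
rewrite expr_pred2_mul //; apply: z1; apply/eqP => /z0 ve.
by rewrite ve eqxx in ve0.
Qed.

Variable ks : seq int.
Hypothesis ksP : orbit_representatives q G a gamma ks.
Local Notation E2 := (left_part iota G a b gamma ks).

Let ks_odd k : k \in ks -> odd `|k|. Proof. by case: ksP => _ + _ _; apply. Qed.

Lemma left_partP e : reflect (exists k sg, k \in ks /\ e = eA k *m hatb F G b sg) (e \in E2).
Proof.
rewrite inE mem_cat (hat_cycle_b F n_ge3 presG).
rewrite -(hatb_true iota n_ge3 presG gamma_faithful).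
apply: (iffP orP) => [[]/mapP[k kk ->]|[k [sg [kk ->]]]].
- by exists k, false.
- by exists k, true.
by case: sg; [right | left]; apply/mapP; exists k.
Qed.

Lemma eA_hatbM k l sg tau : k \in ks -> l \in ks ->
  (eA k *m hatb F G b sg) *m (eA l *m hatb F G b tau) =
  if (k == l) && (sg == tau) then eA k *m hatb F G b sg else 0.
Proof.
move=> kk lk; have hA := hatb_mem F presG sg.
rewrite mulmxA -(mulmxA (eA k)) (eA_center iota a gamma l hA) !mulmxA.
have [<-|kl] /= := eqVneq k l.
  rewrite (eA_idem iota n_ge3 presG q_odd gamma_faithful (ks_odd kk)).
  rewrite -mulmxA (hatb_mul iota n_ge3 presG gamma_faithful).
  by case: eqP => //; rewrite mulmx0.
rewrite eA_orth ?ks_odd ?mul0mx // => sm.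
case: ksP => _ _ inj _; move/eqP: kl; apply.
exact: inj.
Qed.

Lemma eA_hatb_inj : {in [pred ksg : int * bool | ksg.1 \in ks] &,
  injective (fun ksg => eA ksg.1 *m hatb F G b ksg.2)}.
Proof.
move=> [k sg] [l tau] /=; rewrite !inE /= => kk lk eq_e.
have := eA_hatbM sg tau kk lk; rewrite -eq_e eA_hatbM // !eqxx /=.
case: ifP => [/andP[/eqP-> /eqP->] //|_ e0].
have := eA_hatb_neq0 iota n_ge3 presG q_odd gamma_faithful (ks_odd kk) sg.
by rewrite e0 eqxx.
Qed.

Lemma left_idem e : e \in E2 -> [/\ (e \in FG)%MS, e *m e = e & e != 0].
Proof.
case/left_partP => k [sg [kk ->]]; split.
- apply: group_ringM; last exact: (hatb_mem F presG sg).
  exact: (eA_mem iota n_ge3 presG q_odd gamma_faithful (ks_odd kk)).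
- by rewrite eA_hatbM // !eqxx.
exact: (eA_hatb_neq0 iota n_ge3 presG q_odd gamma_faithful (ks_odd kk) sg).
Qed.

Lemma central_idem e : e \in E1 -> [/\ (e \in FG)%MS, e *m e = e & e != 0].
Proof.
case/(central_partP iota n_ge3 presG q_odd gamma_faithful) => eA [psi psiC eO].
split=> //; first exact: (orbit_idem_idem G_L (subxx G) psiC eO).
exact: (orbit_idem_neq0 G_L (subxx G) psiC eO).
Qed.

(** a^s acts as 1 on e and as -1 on f, so the product equals its own negative. *)
Lemma central_left_orth e f : e \in E1 -> f \in E2 -> e *m f = 0 /\ f *m e = 0.
Proof.
move=> E1e E2f; have [fA _ _] := left_idem E2f.
have comm x : (x \in FG)%MS -> x *m e = e *m x.
  have := central_part_center n_ge3 presG q_odd gamma_faithful E1e.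
  by rewrite sub_capmx => /andP[_ /cent_mxP]; apply.
rewrite -(comm f fA); suff -> : f *m e = 0 by [].
apply: (neg_eq0 iota n_ge3 presG gamma_faithful); rewrite comm //.
rewrite -{1}(central_half E1e) comm ?group_ringG ?groupX // -mulmxA.
have /left_partP[k [sg [kk ->]]] := E2f.
rewrite (mulmxA (aG _)) (eA_half iota n_ge3 presG q_odd gamma_faithful (ks_odd kk)).
by rewrite mulNmx mulmxN.
Qed.

Lemma parts_disjoint : [disjoint E1 & E2].
Proof.
rewrite disjoint_subset; apply/subsetP => e E1e; apply/negP => E2e.
have [_ ee e0] := central_idem E1e; have [] := central_left_orth E1e E2e.
by rewrite ee => e00; rewrite e00 eqxx in e0.
Qed.

Lemma parts_orth : {in E1 :|: E2 &, forall e f, e != f -> e *m f = 0}.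
Proof.
move=> e f /setUP[Ee|Ee] /setUP[Ef|Ef] ef.
- have [_ [psi psiC eO]] := (central_partP iota n_ge3 presG q_odd gamma_faithful e).1 Ee.
  have [_ [phi phiC fO]] := (central_partP iota n_ge3 presG q_odd gamma_faithful f).1 Ef.
  apply: (orbit_idem_orth (subxx G) psiC phiC eO fO) => sm; move/eqP: ef; apply.
  exact: (orbit_idem_eq G_L (subxx G) psiC phiC eO fO sm).
- by case: (central_left_orth Ee Ef).
- by case: (central_left_orth Ef Ee).
move: ef; have /left_partP[k [sg [kk ->]]] := Ee; have /left_partP[l [tau [lk ->]]] := Ef.
by rewrite eA_hatbM //; case: ifP => // /andP[/eqP-> /eqP->]; rewrite eqxx.
Qed.

Lemma parts_sum : \sum_(e in E1 :|: E2) e = 1%:M.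
Proof.
set S := \sum_(e in _) e.
have SE e : e \in E1 :|: E2 -> S *m e = e.
  move=> Ee; rewrite /S mulmx_suml (bigD1 e) //=.
  have -> : e *m e = e by case/setUP: Ee => [/central_idem|/left_idem] [].
  by rewrite big1 ?addr0 // => f /andP[Ef fe]; apply: parts_orth.
apply: (map_mx_inj (f := iota)); rewrite map_mx1 -[LHS]mulmx1 -sum_idc mulmx_sumr.
apply: eq_bigr => l _; have [l_odd|l_even] := boolP (odd l).
  (* For l odd, E_l lies under the e_k of its orbit, and e_k is the sum of two members of [E2]. *)
  have [_ _ _ surj] := ksP; have [k kk sm] := surj l%:Z l_odd.
  have absE := eA_absorb (ks_odd kk) sm (in1W (fun=> erefl)).
  rewrite -absE mulmxA -map_mxM; congr (map_mx _ _ *m _).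
  have eE : eA k = eA k *m hatb F G b false + eA k *m hatb F G b true.
    rewrite (hatb_true iota n_ge3 presG gamma_faithful) -mulmxDr addrC subrK.
    by rewrite mulmx1.
  by rewrite {1}eE mulmxDr !SE -?eE // inE; apply/orP; right; apply/left_partP;
    [exists k, true | exists k, false].
pose El := idc G <[a]>%G (fun x => gamma x ^+ l).
pose hL (sg : bool) : 'M[L]_#|G| := 2%:R^-1 *: (1%:M + (-1) ^+ sg *: R b).
have hE : El = hL false *m El + hL true *m El.
  rewrite -mulmxDl -scalerDr expr0 expr1 scale1r scaleN1r addrACA subrr addr0.
  rewrite -mulr2n -scaler_nat scalerA mulVf ?scale1r ?mul1mx //.
  exact: (two_neq0 n_ge3 presG gamma_faithful).
suff SM sg : map_mx iota S *m (hL sg *m El) = hL sg *m El.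
  by rewrite -/El hE mulmxDr !SM.
have lC := lin_char n_ge3 presG gamma_faithful sg l_even.
have [e Ee eO] := central_part_of_char iota n_ge3 presG q_odd gamma_faithful lC.
have Rb : R b *m hL sg = (-1) ^+ sg *: hL sg.
  have RbRb : R b *m R b = 1%:M by rewrite -repr_mxM // (sqr_b presG) repr_mx1.
  rewrite -scalemxAr mulmxDr mulmx1 -scalemxAr RbRb scalerA mulrC -scalerA.
  congr (_ *: _); rewrite scalerDr scalerA -signr_addb addbb expr0 scale1r.
  by rewrite addrC.
have bEl : R b *m El = El *m R b.
  have nb := norm_cycle_b presG.
  have := idc_conj sAG (fun x => gamma x ^+ l) Gb nb.
  have -> : idc G <[a]>%G (fun x => gamma (x ^ b^-1)%g ^+ l) = El.
    apply: idc_ext => x ax; rewrite (inv_b presG).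
    exact: (gamma_conj n_ge3 presG gamma_faithful l_even ax).
  move=> /(congr1 (mulmx (R b))) <-.
  by rewrite !mulmxA -repr_mxM ?groupV // mulgV repr_mx1 mul1mx.
have hEl : hL sg *m El = El *m hL sg.
  rewrite /hL -scalemxAl -[RHS]scalemxAr; congr (_ *: _).
  by rewrite mulmxDl mulmxDr mul1mx mulmx1 -scalemxAl -[in RHS]scalemxAr bEl.
(* For l even, the piece hL E_l is an eigenvector of all of G for [lin l sg], so the member of [E1]
   attached to this character fixes it. *)
have RM g : g \in G -> R g *m (hL sg *m El) = lin l sg g *: (hL sg *m El).
  have RaM i : R (a ^+ i)%g *m (hL sg *m El) = w ^+ l ^+ i *: (hL sg *m El).
    rewrite hEl mulmxA (mul_idc sAG (lchar_exp gC l)) ?mem_cycle // -scalemxAl.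
    by rewrite (lcharX gC) ?cycle_id // exprAC.
  move=> Gg; have [[i ->]|[i ->]] := pres_forms presG Gg.
    by rewrite RaM (lin_expa b gamma_faithful).
  rewrite (lin_expab n_ge3 presG gamma_faithful) repr_mxM ?groupX // -mulmxA.
  by rewrite (mulmxA (R b)) Rb -scalemxAl -scalemxAr RaM scalerA.
have absM := idc_absorb G_L (subxx G) lC RM.
rewrite -absM mulmxA -(orbit_idem_mul G_L (subxx G) eO lC lC (same_refl _ _ _)).1.
by rewrite !mulmxA -map_mxM SE // inE Ee.
Qed.

Lemma parts_complete :
  complete_primitive_orthogonal FG (E1 :|: E2) /\ sum_of_minimal_left_ideals FG (E1 :|: E2).
Proof.
apply: complete_of_minimal.
- exact: group_ringM.
- by move=> e /setUP[/central_idem|/left_idem].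
- move=> e /setUP[Ee|/left_partP[k [sg [kk ->]]]] v vA; first exact: central_inv.
  exact: (eA_hatb_inv n_ge3 presG q_odd gamma_faithful (ks_odd kk) vA).
- exact: parts_orth.
exact: parts_sum.
Qed.

End Complete.

(** * Counting *)

(** The hypothesis says that the fibres of f are the right cosets of U. *)
Lemma card_image_cosets (gT : finGroupType) (U : {group gT}) (T : finType) (f : gT -> T) :
    (forall x y, f x = f y <-> (x * y^-1)%g \in U) ->
  (#|f @: [set: gT]| * #|U| = #|[set: gT]|)%N.
Proof.
move=> fU; have f_repr x : f (repr (U :* x)%g) = f x.
  by apply/fU; have /rcosetP[y Uy ->] := mem_repr_rcoset U x; rewrite mulgK.
have -> : f @: [set: gT] = (fun C : {set gT} => f (repr C)) @: rcosets U [set: gT].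
  apply/setP => y; apply/imsetP/imsetP => [[x _ ->]|[_ /rcosetsP[x _ ->] ->]].
    by exists (U :* x)%g; rewrite ?f_repr // mem_rcosets mulSGid ?subsetT ?inE.
  by exists x.
rewrite card_in_imset => [|_ _ /rcosetsP[x _ ->] /rcosetsP[y _ ->]].
  by rewrite mulnC -[#|rcosets _ _|]/#|[set: gT]%G : U| Lagrange ?subsetT.
by rewrite !f_repr => /fU xy; apply/rcoset_eqP; rewrite mem_rcoset.
Qed.

Lemma card_unit_Zp m : (0 < m)%N -> #|[set: {unit 'Z_m}]| = totient m.
Proof. exact: card_units_Zp. Qed.

Lemma unit_modK m (u : {unit 'Z_m}) : (0 < m)%N ->
  coprime m (FinRing.uval u : nat) /\ unit_mod m (FinRing.uval u : nat) = u.
Proof.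
move=> m_gt0; have [m_gt1|m_le1] := ltnP 1 m; last first.
  have m1 : m = 1%N by apply/eqP; rewrite eqn_leq m_le1 m_gt0.
  by move: u; rewrite m1 => u; split; [apply: coprime1n | apply: unit_Zp1_eq].
have cu : coprime m (FinRing.uval u : nat).
  by rewrite -unitZpE // natr_Zp; apply: valP.
by split=> //; apply: val_inj; rewrite /= unit_mod_val // natr_Zp.
Qed.

Lemma cycle_unit_mod m q u v : (0 < m)%N -> coprime m q -> coprime m u -> coprime m v ->
  (exists t, u * q ^ t = v %[mod m])%N <->
  (unit_mod m u * (unit_mod m v)^-1)%g \in <[unit_mod m q]>%g.
Proof.
move=> m_gt0 cq cu cv.
have eqE t : (u * q ^ t == v %[mod m])%N =
    (unit_mod m u * unit_mod m q ^+ t == unit_mod m v)%g.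
  by rewrite -unit_mod_eq ?coprimeMr ?cu ?coprimeXr // unit_modM ?coprimeXr // unit_modX.
have mC := centsP (units_Zp_abelian m).
set x := unit_mod m u in eqE *; set y := unit_mod m v in eqE *.
rewrite -(groupV _ (x * _)%g) invMg invgK (mC y) ?inE //.
split=> [[t /eqP]|/cycleP[t yx]].
  by rewrite eqE => /eqP <-; rewrite mulKg mem_cycle.
by exists t; apply/eqP; rewrite eqE -yx mulKVg.
Qed.

Section Counting.
Variables (F : finFieldType) (L : closedFieldType) (iota : {rmorphism F -> L}).
Variables (n : nat) (gT : finGroupType) (G : {group gT}) (a b : gT).
Hypotheses (n_ge3 : (3 <= n)%N) (presG : presented_by_ab G n a b).
Hypothesis (q_odd : odd #|F|).
Variables (gamma : gT -> L).
Hypothesis gamma_faithful : faithful_char <[a]> gamma.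
Local Notation N := (2 ^ n)%N.
Local Notation q := #|F|.
Local Notation w := (gamma a).
Local Notation lin := (lin a b gamma).
Local Notation E1 := (central_part iota G n a b).

Let Ga := pres_a presG.
Let Gb := pres_b presG.
Let G_L := card_pres_neq0 n_ge3 presG gamma_faithful.
Let linC l e (l_even : ~~ odd l) : is_char G (lin l e) :=
  lin_char n_ge3 presG gamma_faithful e l_even.

(** q is odd, so Frobenius fixes the sign at b and moves only the value at a. *)
Lemma lin_same l l' (d d' : bool) : ~~ odd l -> ~~ odd l' ->
  cyc_coset q G (lin l d) (lin l' d') <-> d = d' /\ exists t, w ^+ l' = w ^+ (l * q ^ t).
Proof.
move=> l_even l'_even.
have signX t : ((-1 : L) ^+ d) ^+ (q ^ t) = (-1) ^+ d.
  by rewrite exprAC -[(-1) ^+ (q ^ t)]signr_odd oddX q_odd orbT expr1.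
split=> [[t linE]|[<- [t wE]]].
  split; last by exists t; have := linE a Ga; rewrite !lin_a exprM.
  have := linE b Gb; rewrite !(lin_b n_ge3 presG gamma_faithful) signX.
  by move/(signr_inj n_ge3 presG gamma_faithful).
exists t => x Gx; apply/esym.
apply: (lin_ext n_ge3 presG gamma_faithful (lchar_exp (linC d l_even) (q ^ t)) l'_even _ _ Gx).
  by rewrite lin_a wE exprM.
by rewrite (lin_b n_ge3 presG gamma_faithful) signX.
Qed.

Section CentralCount.
Variables (j : nat) (d : bool).
Hypothesis jn : (j < n)%N.

Let lu (u : {unit 'Z_(2 ^ j)}) : nat := (2 ^ (n - j) * (FinRing.uval u : nat))%N.

Let lu_even u : ~~ odd (lu u).
Proof. by rewrite oddM (negPf (even_exp jn)). Qed.

Let m_gt0 : (0 < 2 ^ j)%N. Proof. by rewrite expn_gt0. Qed.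

(** As u runs over the units, w^(lu u) runs over the roots of unity of order exactly 2^j; the block
    collects the idempotents of the characters with such a value at a and the sign d at b. *)
Definition central_block : {set 'M[F]_#|G|} :=
  [set e in E1 | `[< exists u, orbit_idem iota G (lin (lu u) d) e >]].

(** Two units give the same idempotent exactly when their quotient lies in <q> modulo 2^j. *)
Lemma card_central_block :
  (#|central_block| * order_mod (2 ^ j) q = totient (2 ^ j))%N.
Proof.
have fex u : exists e, e \in E1 /\ orbit_idem iota G (lin (lu u) d) e.
  have [e Ee eO] := central_part_of_char iota n_ge3 presG q_odd gamma_faithful (linC d (lu_even u)).
  by exists e.
have [f fP] := choice fex.
have -> : central_block = f @: [set: {unit 'Z_(2 ^ j)}].
  apply/setP => e; rewrite inE; apply/andP/imsetP => [[Ee /asboolP[u eO]]|[u _ ->]].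
    exists u => //; have [_ fO] := fP u.
    exact: (orbit_idem_eq G_L (subxx G) (linC d (lu_even u)) (linC d (lu_even u)) eO fO
      (same_refl _ _ _)).
  by have [Ef fO] := fP u; split=> //; apply/asboolP; exists u.
rewrite -card_unit_Zp // -(card_image_cosets (U := <[unit_mod (2 ^ j) q]>%G) (f := f)) //.
move=> u v; have [cu uK] := unit_modK u m_gt0; have [cv vK] := unit_modK v m_gt0.
have cq := coprime_2X_q q_odd j.
rewrite -{2}uK -{2}vK -cycle_unit_mod //.
have [_ uO] := fP u; have [_ vO] := fP v.
have key : cyc_coset q G (lin (lu u) d) (lin (lu v) d) <->
    (exists t, (FinRing.uval u : nat) * q ^ t = (FinRing.uval v : nat) %[mod 2 ^ j])%N.
  rewrite lin_same //; split=> [[_ [t]]|[t uv]].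
    rewrite /lu -mulnA !(exprM w (2 ^ (n - j))) => /eqP.
    rewrite (eq_prim_root_expr (root_prim n_ge3 presG gamma_faithful (ltnW jn))).
    by move=> /eqP/esym uv; exists t.
  split=> //; exists t; rewrite /lu -mulnA !(exprM w (2 ^ (n - j))); apply/eqP.
  rewrite (eq_prim_root_expr (root_prim n_ge3 presG gamma_faithful (ltnW jn))).
  by rewrite uv.
rewrite -key; split=> [fuv|sm].
  rewrite fuv in uO.
  exact: (orbit_idem_same G_L (subxx G) (linC d (lu_even u)) (linC d (lu_even v)) uO vO).
exact: (orbit_idem_eq G_L (subxx G) (linC d (lu_even u)) (linC d (lu_even v)) uO vO sm).
Qed.

End CentralCount.

(** The sign at b and the order 2^j of the value at a are invariant under Frobenius. *)
Lemma central_block_disjoint j j' d d' : (j < n)%N -> (j' < n)%N -> (j, d) != (j', d') ->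
  [disjoint central_block j d & central_block j' d'].
Proof.
move=> jn j'n neq; rewrite disjoint_subset; apply/subsetP => e.
rewrite !inE => /andP[_ /asboolP[u uO]]; apply/negP => /andP[_ /asboolP[v vO]].
have Cu : ~~ odd (2 ^ (n - j) * (FinRing.uval u : nat)) by rewrite oddM (negPf (even_exp jn)).
have Cv : ~~ odd (2 ^ (n - j') * (FinRing.uval v : nat)) by rewrite oddM (negPf (even_exp j'n)).
have := orbit_idem_same G_L (subxx G) (linC d Cu) (linC d' Cv) uO vO.
case/lin_same => // dd [t wE]; move/eqP: neq; apply; rewrite -{}dd; congr (_, _).
have pu : (2 ^ j).-primitive_root (w ^+ (2 ^ (n - j) * (FinRing.uval u : nat) * q ^ t)).
  rewrite -mulnA exprM prim_root_exp_coprime ?(root_prim n_ge3 presG gamma_faithful) 1?ltnW //.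
  have [cu _] := unit_modK u (expn_gt0 2 j : (0 < 2 ^ j)%N).
  by rewrite coprime_sym coprimeMr cu coprimeXr // coprime_2X_q.
have pv : (2 ^ j').-primitive_root (w ^+ (2 ^ (n - j') * (FinRing.uval v : nat))).
  rewrite exprM prim_root_exp_coprime ?(root_prim n_ge3 presG gamma_faithful) 1?ltnW //.
  have [cv _] := unit_modK v (expn_gt0 2 j' : (0 < 2 ^ j')%N).
  by rewrite coprime_sym.
rewrite wE in pv; apply/eqP; rewrite -(eqn_exp2l _ _ (ltnSn 1)) eqn_dvd.
by rewrite !(prim_order_dvd pu, prim_order_dvd pv) (prim_expr_order pu) (prim_expr_order pv) eqxx.
Qed.

Lemma central_partE : E1 = \bigcup_(jd : 'I_n * bool) central_block jd.1 jd.2.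
Proof.
apply/setP => e; apply/idP/bigcupP => [Ee|[jd _]]; last by rewrite inE => /andP[].
have [_ [psi psiC eO]] := (central_partP iota n_ge3 presG q_odd gamma_faithful e).1 Ee.
have [l [d [l_even _ psiE]]] := lin_surj n_ge3 presG gamma_faithful psiC.
have [j [u [jn u_odd linE]]] := lin_odd_part n_ge3 presG gamma_faithful d l_even.
exists (Ordinal jn, d) => //=; rewrite inE Ee; apply/asboolP.
exists (unit_mod (2 ^ j) u); apply: orbit_idem_ext eO => x Gx; rewrite psiE // linE //.
have cu : coprime (2 ^ j) u by rewrite coprimeXl // coprime2n.
have m_gt0 : (0 < 2 ^ j)%N by rewrite expn_gt0.
have [cv vK] := unit_modK (unit_mod (2 ^ j) u) m_gt0.
have l1 : ~~ odd (2 ^ (n - j) * u) by rewrite oddM (negPf (even_exp jn)).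
apply: (lin_ext n_ge3 presG gamma_faithful (linC d l1) _ _ _ Gx).
- by rewrite oddM (negPf (even_exp jn)).
- rewrite lin_a !exprM; apply/eqP.
  rewrite (eq_prim_root_expr (root_prim n_ge3 presG gamma_faithful (ltnW jn))).
  by rewrite -unit_mod_eq // vK.
by rewrite (lin_b n_ge3 presG gamma_faithful).
Qed.

(** The constant 4 comes from j = 0 and j = 1, each with two signs, where the unit group modulo 2^j
    is trivial; the factor 2 is the choice of sign for the other j. *)
Lemma card_central_part : (#|E1|%:R = 4 + 2 * \sum_(2 <= j < n)
  (totient (2 ^ j))%:R / (order_mod (2 ^ j) q)%:R :> rat).
Proof.
have -> : #|E1| = (\sum_(jd : 'I_n * bool) #|central_block jd.1 jd.2|)%N.
  rewrite -sum1_card central_partE partition_disjoint_bigcup => [|jd jd' neq].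
    by apply: eq_bigr => jd _; rewrite sum1_card.
  by apply: central_block_disjoint => //; case: jd jd' neq => [j d] [j' d'].
rewrite natr_sum (eq_bigr (fun jd : 'I_n * bool =>
    (totient (2 ^ jd.1))%:R / (order_mod (2 ^ jd.1) q)%:R : rat)) => [|[j d] _ /=]; last first.
  rewrite -(card_central_block d (ltn_ord j)) natrM mulfK //.
  by rewrite Num.Theory.pnatr_eq0 -lt0n order_mod_gt0.
rewrite -(pair_big xpredT xpredT (fun (j : 'I_n) (d : bool) =>
   (totient (2 ^ j))%:R / (order_mod (2 ^ j) q)%:R : rat)) /=.
under eq_bigr do rewrite big_bool /= -mulr2n.
have order1 j : (j < 2)%N -> (totient (2 ^ j))%:R / (order_mod (2 ^ j) q)%:R = 1 :> rat.
  move=> j_lt2; have t1 : totient (2 ^ j) = 1%N by case: j j_lt2 => [|[|]].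
  have : (order_mod (2 ^ j) q %| #|[set: {unit 'Z_(2 ^ j)}]|)%N.
    by rewrite order_dvdG ?inE.
  by rewrite card_unit_Zp ?expn_gt0 // t1 dvdn1 => /eqP->; rewrite divr1.
rewrite -(big_mkord xpredT (fun j => ((totient (2 ^ j))%:R / (order_mod (2 ^ j) q)%:R) *+ 2 : rat)).
rewrite big_ltn ?(leq_trans _ n_ge3) // big_ltn ?(leq_trans _ n_ge3) // !order1 //.
by rewrite sumrMnl addrA -mulrnDr [2 * _]mulr_natl.
Qed.

End Counting.

(** * Counting the components of faithful characters *)

Section LeftCount.
Variables (F : finFieldType) (L : closedFieldType) (iota : {rmorphism F -> L}).
Variables (n : nat) (gT : finGroupType) (G : {group gT}) (a b : gT).
Hypotheses (n_ge3 : (3 <= n)%N) (presG : presented_by_ab G n a b).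
Hypothesis (q_odd : odd #|F|).
Variables (gamma : gT -> L).
Hypothesis gamma_faithful : faithful_char <[a]> gamma.
Local Notation N := (2 ^ n)%N.
Local Notation s := (2 ^ n.-1)%N.
Local Notation q := #|F|.
Local Notation aG := (regular_repr F G).
Local Notation eA k := (eC_cyclic iota G a gamma k).
Local Notation uq := (unit_mod N q).
Local Notation us := (unit_mod N (1 + s)).

Let Ga := pres_a presG.
Let Gb := pres_b presG.
Let sAG : <[a]>%G \subset G := cycle_a_sub presG.
Let gC := gamma_char gamma_faithful.
Let prim := gamma_prim n_ge3 presG gamma_faithful.
Let G_L := card_pres_neq0 n_ge3 presG gamma_faithful.
Let N_gt0 : (0 < N)%N. Proof. by rewrite expn_gt0. Qed.
Let co_q : coprime N q. Proof. exact: coprime_2X_q. Qed.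

Let co_s : coprime N (1 + s).
Proof. by rewrite coprimeXl // coprime2n oddD (negPf (s_even n_ge3)). Qed.

Lemma gring_conj_conj g x : g \in G ->
  gring_conjugates (aG g^-1%g *m x *m aG g) = gring_conjugates x.
Proof.
move=> Gg; apply/setP => y; apply/imsetP/imsetP => [[h Gh ->]|[h Gh ->]].
  exists (g * h)%g; rewrite ?groupM // invMg !repr_mxM ?groupV //.
  by rewrite !mulmxA.
exists (g^-1 * h)%g; rewrite ?groupM ?groupV // invMg invgK !repr_mxM ?groupV //.
have VK m (y1 : 'M[F]_(m, #|G|)) : y1 *m aG g *m aG g^-1%g = y1.
  by rewrite -mulmxA -repr_mxM ?groupV // mulgV repr_mx1 mulmx1.
by rewrite !mulmxA !VK.
Qed.

Lemma eA_eq k l : odd `|k| -> odd `|l| -> same_orbit q G a gamma k l -> eA k = eA l.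
Proof.
move=> k_odd l_odd /(same_orbitP n_ge3 presG q_odd gamma_faithful)[g Gg sm].
have [kC kO] := gring_conjugates_orbit iota n_ge3 presG q_odd gamma_faithful k_odd Gg.
have [m [m_odd lm lO]] := epsA_char iota n_ge3 presG q_odd gamma_faithful l_odd.
have mC := gamma_exp_char gamma_faithful m.
have sm' : cyc_coset q <[a]>%G (fun x => gamma (x ^ g^-1)%g ^ k) (fun x => gamma x ^+ m).
  by case: sm => t tE; exists t => y ay; rewrite -lm // tE.
by rewrite !eA_sum -(orbit_idem_eq G_L sAG kC mC kO lO sm') gring_conj_conj.
Qed.

(** d records the class of the conjugating element modulo <a>: b multiplies exponents by 1+s, and
    Frobenius by q. *)
Lemma same_orbit_mod (k l : nat) :
  same_orbit q G a gamma k l <->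
  exists (d : bool) t, (k * (1 + s) ^ d * q ^ t = l %[mod N])%N.
Proof.
split=> [/(same_orbitP n_ge3 presG q_odd gamma_faithful)[g Gg [t tE]]|[d [t klE]]].
  have [k' k'E kg] := conj_exp presG gamma_faithful k Gg.
  have /eqP := tE a (cycle_id a); rewrite -!exprnP kg ?cycle_id // -exprM.
  rewrite (eq_prim_root_expr prim) eq_sym => /eqP klE.
  by case: k'E klE => ->; [exists false, t; rewrite expn0 muln1 | exists true, t; rewrite expn1].
apply/(same_orbitP n_ge3 presG q_odd gamma_faithful).
have aE x : x \in <[a]> -> gamma x ^ (l : int) = gamma x ^+ (k * (1 + s) ^ d * q ^ t).
  case/cycleP=> i ->; rewrite -exprnP !(lcharX gC) ?cycle_id // exprAC [RHS]exprAC.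
  by congr (_ ^+ _); apply/eqP; rewrite (eq_prim_root_expr prim) klE.
exists (if d then b else 1%g); first by case: d {klE aE}.
exists t => x ax; rewrite aE // exprM -exprnP; congr (_ ^+ _).
case: d {klE aE}; last by rewrite invg1 conjg1 muln1.
by rewrite (inv_b presG) (conj_ab presG ax) (lcharX gC) // -exprM mulnC.
Qed.

(** (1+s)^2 = 1 + 2s + s^2, where 2s = N and N divides s^2. *)
Lemma us_sqr : (us ^+ 2 = 1)%g.
Proof.
rewrite -unit_modX // -unit_mod1 //; apply/eqP; rewrite unit_mod_eq ?coprimen1 ?coprimeXr //.
rewrite sqrnD exp1n mul1n -expnS prednK ?(leq_trans _ n_ge3) //.
rewrite -expnM modnDr -[X in _ == X %[mod _]]addn0 eqn_modDl mod0n.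
rewrite -/(dvdn _ _) dvdn_exp2l //; case: n n_ge3 => [|[|m]] // _.
by rewrite muln2 -addnn /= addSnnS leq_addl.
Qed.

Lemma us_neq1 : us != 1%g.
Proof.
rewrite -unit_mod1 // unit_mod_eq ?coprimen1 // -[X in _ == X %[mod _]]addn0 eqn_modDl.
rewrite mod0n -/(dvdn _ _) gtnNdvd ?expn_gt0 // ltn_exp2l // prednK //.
exact: leq_trans n_ge3.
Qed.

Definition orbit_group : {group {unit 'Z_N}} := (<[uq]> <*> <[us]>)%G.

Let mC : commutative (@mulg {unit 'Z_N}).
Proof. by move=> x y; apply: (centsP (units_Zp_abelian N)); rewrite inE. Qed.

Let orbit_groupE : orbit_group :=: (<[uq]> * <[us]>)%g.
Proof.
apply: cent_joinEr; apply: (subset_trans (subsetT _)).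
by apply/centsP => x _ y _; apply: mC.
Qed.

(** The origin of kappa: 1+s has order 2 modulo N, so it either lies in <q> or generates a group
    that meets <q> trivially and doubles the order. *)
Lemma card_orbit_group :
  #|orbit_group| = ((if us \in <[uq]>%g then 1 else 2) * order_mod N q)%N.
Proof.
have os : #[us]%g = 2.
  apply/eqP; rewrite eqn_leq dvdn_leq ?order_dvdn ?us_sqr //=.
  by rewrite ltnNge leq_eqVlt ltnS leqn0 order_eq1 (negPf us_neq1) eqn0Ngt order_gt0.
case: ifPn => [uU|uU].
  rewrite mul1n /orbit_group /=; congr #|pred_of_set _|.
  by apply/joing_idPl; rewrite cycle_subG.
rewrite orbit_groupE TI_cardMg -?orderE ?os 1?mulnC // setIC.
by apply: prime_TIg; rewrite -?orderE ?os // cycle_subG.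
Qed.

Lemma mem_orbit_group (u v : {unit 'Z_N}) :
  (u * v^-1)%g \in orbit_group <->
  exists (d : bool) t, (u * us ^+ d * uq ^+ t = v)%g.
Proof.
rewrite -groupV invMg invgK mC orbit_groupE; split.
  case/mulsgP => _ _ /cycleP[t ->] /cycleP[i ->] /(canRL (mulKVg u)) ->.
  exists (odd i), t; rewrite -mulgA; congr (_ * _)%g; rewrite mC; congr (_ * _)%g.
  rewrite -{2}(odd_double_half i) expgD -mul2n expgM us_sqr expg1n.
  by rewrite mulg1.
case=> d [t <-]; rewrite -mulgA mulKg mC.
by rewrite mem_mulg ?mem_cycle.
Qed.

Variable ks : seq int.
Hypothesis ksP : orbit_representatives q G a gamma ks.

Let ks_odd k : k \in ks -> odd `|k|. Proof. by case: ksP => _ + _ _; apply. Qed.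

(** Sending a unit u to e_u has the cosets of <q, 1+s> as fibres, and its image consists of the e_k
    with k in [ks], which are pairwise distinct. *)
Lemma card_orbits : (size ks * #|orbit_group| = totient N)%N.
Proof.
pose f (u : {unit 'Z_N}) := eA (FinRing.uval u : nat).
have u_odd (u : {unit 'Z_N}) : odd `|(FinRing.uval u : nat)%:Z|.
  have [co _] := unit_modK u N_gt0.
  by rewrite absz_nat -coprime2n -(coprime_pexpl (k := n)) // (leq_trans _ n_ge3).
have fU u v : f u = f v <-> (u * v^-1)%g \in orbit_group.
  have [cu uK] := unit_modK u N_gt0; have [cv vK] := unit_modK v N_gt0.
  have -> : (u * v^-1)%g \in orbit_group <->
      same_orbit q G a gamma (FinRing.uval u : nat) (FinRing.uval v : nat).
    rewrite same_orbit_mod mem_orbit_group.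
    suff E (d : bool) t : (u * us ^+ d * uq ^+ t = v)%g <->
        ((FinRing.uval u : nat) * (1 + s) ^ d * q ^ t = (FinRing.uval v : nat) %[mod N])%N.
      by split=> -[d [t /E h]]; exists d, t.
    have cud : coprime N ((FinRing.uval u : nat) * (1 + s) ^ d).
      by rewrite coprimeMr cu coprimeXr.
    rewrite -{1}uK -{1}vK -!unit_modX // -!unit_modM ?coprimeXr //.
    split=> /eqP; first by rewrite unit_mod_eq ?coprimeMr ?cu ?coprimeXr // => /eqP.
    by move=> h; apply/eqP; rewrite unit_mod_eq ?coprimeMr ?cu ?coprimeXr.
  split=> [fuv|sm]; last by apply: eA_eq; rewrite ?u_odd.
  apply: contrapT => ns.
  have := eA_orth iota n_ge3 presG q_odd gamma_faithful (u_odd u) (u_odd v) ns.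
  rewrite -/(f u) -/(f v) -fuv (eA_idem iota n_ge3 presG q_odd gamma_faithful (u_odd u)).
  by apply/eqP; apply: (eA_neq0 iota n_ge3 presG q_odd gamma_faithful (u_odd u)).
have inj : {in ks &, injective (fun k => eA k)}.
  move=> k l kk lk kl.
  have := @eA_hatb_inj _ _ iota _ _ _ _ _ n_ge3 presG q_odd _ gamma_faithful _ ksP
    (k, false) (l, false).
  by rewrite !inE /= kl => /(_ kk lk erefl) [].
have ksU : uniq ks by case: ksP.
have <- : #|[set:: [seq eA k | k <- ks]]| = size ks.
  rewrite cardsE -(size_map (fun k => eA k)); apply/card_uniqP.
  by rewrite map_inj_in_uniq.
rewrite -card_unit_Zp // -(card_image_cosets fU); congr (#|pred_of_set _| * _)%N.
apply/setP => e; rewrite inE; apply/mapP/imsetP => [[k kk ->]|[u _ ->]].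
  (* k may be negative; a natural exponent l with the same effect on gamma provides the unit. *)
  have [l lk kl] := gamma_exprz n_ge3 presG gamma_faithful k.
  have l_odd : odd l by rewrite lk ks_odd.
  have cl : coprime N l by rewrite coprimeXl // coprime2n.
  exists (unit_mod N l) => //; apply: (eA_eq (ks_odd kk) (u_odd _)).
  apply/(same_orbitP n_ge3 presG q_odd gamma_faithful); exists 1%g => //.
  have [cu uK] := unit_modK (unit_mod N l) N_gt0.
  exists 0%N => x ax; rewrite invg1 conjg1 expn0 expr1 kl //.
  case/cycleP: ax => i ->; rewrite -exprnP !(lcharX gC) ?cycle_id // exprAC [RHS]exprAC.
  by congr (_ ^+ _); apply/eqP; rewrite (eq_prim_root_expr prim) -unit_mod_eq // uK.
have [_ _ _ surj] := ksP; have [k kk sm] := surj (FinRing.uval u : nat)%:Z (u_odd u).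
by exists k => //; apply/esym/(eA_eq (ks_odd kk) (u_odd _)).
Qed.

Lemma card_left_part : #|left_part iota G a b gamma ks| = (2 * size ks)%N.
Proof.
have inj sg tau k l : k \in ks -> l \in ks ->
    eA k *m hatb F G b sg = eA l *m hatb F G b tau -> (k, sg) = (l, tau).
  move=> kk lk.
  exact: (@eA_hatb_inj _ _ iota _ _ _ _ _ n_ge3 presG q_odd _ gamma_faithful _ ksP
    (k, sg) (l, tau)).
rewrite /left_part (hat_cycle_b F n_ge3 presG).
rewrite -(hatb_true iota n_ge3 presG gamma_faithful) cardsE.
rewrite (card_uniqP _) ?size_cat ?size_map ?addnn ?mul2n //.
have ksU : uniq ks by case: ksP.
rewrite cat_uniq !map_inj_in_uniq ?ksU ?andbT //=; try by move=> k l kk lk /inj-/(_ kk lk) [].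
apply/hasPn => _ /mapP[k kk ->]; apply/mapP => -[l lk] /inj-/(_ kk lk).
by [].
Qed.

End LeftCount.

Theorem corollary3p8 (n p r q : nat) (hn : (3 <= n)%N)
    (hp : prime p) (hpodd : odd p) (hr : (0 < r)%N) (hq : q = (p ^ r)%N)
    (F : finFieldType) (hF : #|F| = q)
    (Fbar : closedFieldType) (iota : {rmorphism F -> Fbar})
    (halg : integralRange iota)
    (gT : finGroupType) (G : {group gT}) (a b : gT)
    (hG : presented_by_ab G n a b)
    (gamma : gT -> Fbar) (hgamma : faithful_char <[a]> gamma)
    (ks : seq int) (hks : orbit_representatives q G a gamma ks) :
  let E1 := central_part iota G n a b in
  let E2 := left_part iota G a b gamma ks in
  let kappa := if unit_mod (2 ^ n) (1 + 2 ^ n.-1) \in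
                    <[unit_mod (2 ^ n) q]>%g then 1%N else 2%N in
  [/\ complete_primitive_orthogonal (group_ring F G) (E1 :|: E2),
      sum_of_minimal_left_ideals (group_ring F G) (E1 :|: E2),
      [disjoint E1 & E2],
      {in E1, forall e, (e \in 'Z(group_ring F G))%MS}
    & (#|E1|%:R = 4 + 2 * \sum_(2 <= j < n)
                     (totient (2 ^ j))%:R / (order_mod (2 ^ j) q)%:R :> rat) /\
      (#|E2|%:R = 2 * ((totient (2 ^ n))%:R /
                     (kappa%:R * (order_mod (2 ^ n) q)%:R)) :> rat)].
Proof.
have q_odd : odd #|F| by rewrite hF hq oddX hpodd orbT.
move=> E1 E2 kappa; rewrite -hF in hks kappa *.
have [complete minimal] := parts_complete iota hn hG q_odd hgamma hks.
split=> //.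
- exact: (parts_disjoint iota hn hG q_odd hgamma hks).
- exact: (central_part_center hn hG q_odd hgamma).
split; first exact: (card_central_part iota hn hG q_odd hgamma).
rewrite (card_left_part iota hn hG q_odd hgamma hks).
(* totient(2^n) is the number of orbits times the order of <q, 1+s>, and this order is kappa times
   the order of q. *)
rewrite -(card_orbits iota hn hG q_odd hgamma hks) (card_orbit_group F hn).
rewrite -/kappa !natrM mulfK // mulf_neq0 // Num.Theory.pnatr_eq0 -lt0n ?order_mod_gt0 //.
by rewrite /kappa; case: ifP.
Qed.
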